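(* Let $(E,\omega)$ be a finite weighted graph. Then there exists a universal $(E,\omega)$-dynamical system $(\Omega(E,\omega),\theta)$. Moreover, $\theta$ can be extended to a partial action (also denoted $\theta$) of the free group $\mathbb F$ on $\{e_i: e\in E^1,1\le i\le\omega(e)\}$ on the space $\Omega(E,\omega)$ (the generator $e_i$ acting by $\theta_{e_i}$), and we have $$L^{\mathrm{ab}}(E,\omega)\cong C_K(\Omega(E,\omega))\rtimes_\theta\mathbb F$$ as $*$-algebras.
   Context: Fix a field $K$ with an involution $*$. All algebras are $*$-algebras over $K$, and all presentations are taken in the category of $*$-algebras. A directed graph is $E=(E^0,E^1,r,s)$; $E^0_{\mathrm{reg}}=\{v: s^{-1}(v)\ne\emptyset\}$ (for $E$ row-finite). A weighted graph $(E,\omega)$ is a row-finite graph $E$ with no isolated vertices (no $v$ with $s^{-1}(v)=r^{-1}(v)=\emptyset$) with a map $\omega\colon E^1\to\mathbb N=\{1,2,\dots\}$; it is finite if $E^0$ and $E^1$ are finite. Put $\omega(v)=\max\{\omega(e):e\in s^{-1}(v)\}$ for $v\in E^0_{\mathrm{reg}}$ and $\omega(v)=0$ for a sink $v$. $L_1(E,\omega)$ is the $*$-algebra generated by $\{v,e_i\mid v\in E^0,e\in E^1,1\le i\le\omega(e)\}$ subject to: (1) $uv=\delta_{u,v}u$, $v=v^*$; (2) $s(e)e_i=e_i=e_ir(e)$; (3) $e_ie_j^*=0$ for $e\in E^1$, $1\le i,j\le\omega(e)$, $i\ne j$; (4) $e_i^*f_i=0$ for $e,f\in s^{-1}(v)$,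 $e\neq f$, $v\in E^0$, $1\le i\le\min\{\omega(e),\omega(f)\}$; (5) $\sum_{e\in s^{-1}(v),\,\omega(e)\ge i}e_ie_i^*=v$ for $v\in E^0_{\mathrm{reg}}$, $1\le i\le\omega(v)$; (6) $\sum_{1\le i\le\omega(e)}e_i^*e_i=r(e)$ for $e\in E^1$. The $e_i$ are partial isometries. The abelianized Leavitt path algebra is $L^{\mathrm{ab}}(E,\omega)=L_1(E,\omega)/J$, where $U$ is the multiplicative $*$-subsemigroup of $L_1(E,\omega)$ generated by the $e_i$ ($e\in E^1$, $1\le i\le\omega(e)$) and $J$ is the ideal generated by all commutators $[uu^*,u'u'^*]$, $u,u'\in U$. An $(E,\omega)$-dynamical system $(\Omega,\theta)$ consists of a compact Hausdorff space $\Omega$ with a family of clopen sets $\{\Omega_v\}_{v\in E^0}$ such that $\Omega=\bigsqcup_{v\in E^0}\Omega_v$, and, for each $v\in E^0$, clopen subsets $H_{\alpha^i(e)}$ for $e\in s^{-1}(v)$, $1\le i\le\omega(e)$, and $H_{\alpha^e(i)}$ for $e\in r^{-1}(v)$, $1\le i\le\omega(e)$, such that $\Omega_v=\bigsqcup_{e\in s^{-1}(v):\,\omega(e)\ge i}H_{\alpha^i(e)}$ for $v\in E^0$, $1\le i\le\omega(v)$, and $\Omega_v=\bigsqcup_{i=1}^{\omega(e)}H_{\alpha^e(i)}$ for $v\in E^0$, $e\in r^{-1}(v)$; together with homeomorphisms $\theta_{e_i}\colon H_{\alpha^e(i)}\to H_{\alpha^i(e)}$ for each $e\in E^1$, $1\le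 i\le\omega(e)$. Given two $(E,\omega)$-dynamical systems $(\Omega,\theta)$, $(\Omega',\theta')$, an equivariant map is a map $f\colon\Omega\to\Omega'$ with $f(\Omega_v)\subseteq\Omega'_v$ for $v\in E^0$, $f(H_{\alpha^i(e)})\subseteq H'_{\alpha^i(e)}$ and $f(H_{\alpha^e(i)})\subseteq H'_{\alpha^e(i)}$ for $e\in E^1$, $1\le i\le\omega(e)$, and $\theta'_{e_i}(f(x))=f(\theta_{e_i}(x))$ for all $x\in H_{\alpha^e(i)}$. An $(E,\omega)$-dynamical system $(\Omega,\theta)$ is universal if for every $(E,\omega)$-dynamical system $(\Omega',\theta')$ there is a unique equivariant continuous map $f\colon\Omega'\to\Omega$. $C_K(\Omega)$ is the $*$-algebra of continuous (equivalently locally constant) functions $\Omega\to K$, $K$ discrete. A partial action of a group $G$ on $\Omega$ (with clopen domains) is a family of homeomorphisms $\theta_g\colon\Omega_{g^{-1}}\to\Omega_g$ between clopen subsets with $\theta_1=\mathrm{id}_\Omega$ and $\theta_{gh}$ extending $\theta_g\circ\theta_h$ (defined where the composition makes sense). It induces isomorphisms $\theta_g\colon C_K(\Omega_{g^{-1}})\to C_K(\Omega_g)$, $f\mapsto f\circ\theta_{g^{-1}}$, and $C_K(\Omega)\rtimes_\theta G=\bigoplus_{g\in G}C_K(\Omega_g)\delta_g$ with $(a\delta_g)(b\delta_h)=\theta_g(\theta_{g^{-1}}(a)b)\delta_{gh}$ and $(a\delta_g)^*=\theta_{g^{-1}}(a^* )\delta_{g^{-1}}$. *)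

(* Defs.v *)
From HB Require Import structures.
From mathcomp Require Import all_boot all_algebra finmap.
From mathcomp Require Import all_classical topology.

Set Implicit Arguments.
Unset Strict Implicit.
Unset Printing Implicit Defensive.

Import GRing.Theory.

Local Open Scope classical_set_scope.
Local Open Scope quotient_scope.
Local Open Scope ring_scope.

Record fieldInvolution (K : fieldType) := FieldInvolution {
  invol_fun :> {rmorphism K -> K};
  involK : involutive invol_fun }.

(* Algebras are not assumed to be unital. *)
Record starAlgebra (K : fieldType) (conj : fieldInvolution K) := StarAlgebra {
  sa_sort :> lmodType K;
  sa_mul : sa_sort -> sa_sort -> sa_sort;
  sa_star : sa_sort -> sa_sort;
  sa_mulA : associative sa_mul;
  sa_mulDl : left_distributive sa_mul +%R;
  sa_mulDr : right_distributive sa_mul +%R;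
  sa_mulZl : forall c x y, sa_mul (c *: x) y = c *: sa_mul x y;
  sa_mulZr : forall c x y, sa_mul x (c *: y) = c *: sa_mul x y;
  sa_starK : involutive sa_star;
  sa_starD : {morph sa_star : x y / x + y};
  sa_starM : {morph sa_star : x y / sa_mul x y >-> sa_mul y x};
  sa_starZ : forall c x, sa_star (c *: x) = conj c *: sa_star x }.

Definition star_isomorphic (K : fieldType) (conj : fieldInvolution K)
    (A B : starAlgebra conj) : Prop :=
  exists f : {linear A -> B},
    [/\ bijective f,
        {morph f : x y / sa_mul x y} &
        {morph f : x / sa_star x}].

(* A *-algebra up to the equivalence relation [ps_eqv]; both presentations and
   quotients by *-ideals are obtained by dividing out such a relation. *)
Record preStarAlgebra (K : fieldType) (conj : fieldInvolution K)
    (T : choiceType) := PreStarAlgebra {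
  ps_eqv : T -> T -> Prop;
  ps_zero : T;
  ps_opp : T -> T;
  ps_add : T -> T -> T;
  ps_scale : K -> T -> T;
  ps_mul : T -> T -> T;
  ps_star : T -> T;
  ps_refl : forall x, ps_eqv x x;
  ps_sym : forall x y, ps_eqv x y -> ps_eqv y x;
  ps_trans : forall y x z, ps_eqv x y -> ps_eqv y z -> ps_eqv x z;
  ps_oppE : forall x x', ps_eqv x x' -> ps_eqv (ps_opp x) (ps_opp x');
  ps_addE : forall x x' y y', ps_eqv x x' -> ps_eqv y y' ->
    ps_eqv (ps_add x y) (ps_add x' y');
  ps_scaleE : forall c x x', ps_eqv x x' -> ps_eqv (ps_scale c x) (ps_scale c x');
  ps_mulE : forall x x' y y', ps_eqv x x' -> ps_eqv y y' ->
    ps_eqv (ps_mul x y) (ps_mul x' y');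
  ps_starE : forall x x', ps_eqv x x' -> ps_eqv (ps_star x) (ps_star x');
  ps_addA : forall x y z, ps_eqv (ps_add x (ps_add y z)) (ps_add (ps_add x y) z);
  ps_addC : forall x y, ps_eqv (ps_add x y) (ps_add y x);
  ps_add0 : forall x, ps_eqv (ps_add ps_zero x) x;
  ps_addN : forall x, ps_eqv (ps_add (ps_opp x) x) ps_zero;
  ps_scaleA : forall c d x,
    ps_eqv (ps_scale c (ps_scale d x)) (ps_scale (c * d) x);
  ps_scale1 : forall x, ps_eqv (ps_scale 1 x) x;
  ps_scaleDr : forall c x y,
    ps_eqv (ps_scale c (ps_add x y)) (ps_add (ps_scale c x) (ps_scale c y));
  ps_scaleDl : forall c d x,
    ps_eqv (ps_scale (c + d) x) (ps_add (ps_scale c x) (ps_scale d x));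
  ps_mulA : forall x y z, ps_eqv (ps_mul x (ps_mul y z)) (ps_mul (ps_mul x y) z);
  ps_mulDl : forall x y z,
    ps_eqv (ps_mul (ps_add x y) z) (ps_add (ps_mul x z) (ps_mul y z));
  ps_mulDr : forall x y z,
    ps_eqv (ps_mul x (ps_add y z)) (ps_add (ps_mul x y) (ps_mul x z));
  ps_mulZl : forall c x y,
    ps_eqv (ps_mul (ps_scale c x) y) (ps_scale c (ps_mul x y));
  ps_mulZr : forall c x y,
    ps_eqv (ps_mul x (ps_scale c y)) (ps_scale c (ps_mul x y));
  ps_starK : forall x, ps_eqv (ps_star (ps_star x)) x;
  ps_starD : forall x y,
    ps_eqv (ps_star (ps_add x y)) (ps_add (ps_star x) (ps_star y));
  ps_starM : forall x y,
    ps_eqv (ps_star (ps_mul x y)) (ps_mul (ps_star y) (ps_star x));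
  ps_starZ : forall c x,
    ps_eqv (ps_star (ps_scale c x)) (ps_scale (conj c) (ps_star x)) }.

Section StarQuotient.
Variables (K : fieldType) (conj : fieldInvolution K) (T : choiceType).
Variable S : preStarAlgebra conj T.

Definition ps_rel : rel T := fun x y => `[< ps_eqv S x y >].

Lemma ps_rel_refl : reflexive ps_rel.
Proof. by move=> x; apply/asboolP/ps_refl. Qed.

Lemma ps_rel_sym : symmetric ps_rel.
Proof. by move=> x y; apply/asboolP/asboolP; apply: ps_sym. Qed.

Lemma ps_rel_trans : transitive ps_rel.
Proof.
by move=> y x z /asboolP xy /asboolP yz; apply/asboolP/(ps_trans xy yz).
Qed.

Definition ps_equiv : equiv_rel T :=
  EquivRel ps_rel ps_rel_refl ps_rel_sym ps_rel_trans.

Definition ps_quot : Type := {eq_quot ps_equiv}.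

HB.instance Definition _ := Choice.on ps_quot.

Definition ps_class (x : T) : ps_quot := \pi_{eq_quot ps_equiv} x.
Definition ps_repr (q : ps_quot) : T := repr (q : {eq_quot ps_equiv}).

Lemma ps_reprK q : ps_class (ps_repr q) = q.
Proof. exact: reprK. Qed.

Lemma ps_classP x y : ps_class x = ps_class y <-> ps_eqv S x y.
Proof. by split=> [/eqmodP/asboolP //|xy]; apply/eqmodP/asboolP. Qed.

Lemma ps_repr_class x : ps_eqv S (ps_repr (ps_class x)) x.
Proof. by apply/ps_classP; rewrite ps_reprK. Qed.

Definition psq_opp p := ps_class (ps_opp S (ps_repr p)).
Definition psq_add p q := ps_class (ps_add S (ps_repr p) (ps_repr q)).
Definition psq_scale c p := ps_class (ps_scale S c (ps_repr p)).
Definition psq_mul p q := ps_class (ps_mul S (ps_repr p) (ps_repr q)).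
Definition psq_star p := ps_class (ps_star S (ps_repr p)).

Lemma psq_oppE x : psq_opp (ps_class x) = ps_class (ps_opp S x).
Proof. exact/ps_classP/ps_oppE/ps_repr_class. Qed.

Lemma psq_addE x y :
  psq_add (ps_class x) (ps_class y) = ps_class (ps_add S x y).
Proof. by apply/ps_classP/ps_addE; apply: ps_repr_class. Qed.

Lemma psq_scaleE c x : psq_scale c (ps_class x) = ps_class (ps_scale S c x).
Proof. exact/ps_classP/ps_scaleE/ps_repr_class. Qed.

Lemma psq_mulE x y :
  psq_mul (ps_class x) (ps_class y) = ps_class (ps_mul S x y).
Proof. by apply/ps_classP/ps_mulE; apply: ps_repr_class. Qed.

Lemma psq_starE x : psq_star (ps_class x) = ps_class (ps_star S x).
Proof. exact/ps_classP/ps_starE/ps_repr_class. Qed.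

Definition psqE := (psq_oppE, psq_addE, psq_scaleE, psq_mulE, psq_starE).

Lemma ps_quotW (P : ps_quot -> Prop) : (forall x, P (ps_class x)) -> forall q, P q.
Proof. by move=> PP q; rewrite -(ps_reprK q). Qed.

Lemma psq_addA : associative psq_add.
Proof.
elim/ps_quotW=> x; elim/ps_quotW=> y; elim/ps_quotW=> z.
by rewrite !psqE; apply/ps_classP/ps_addA.
Qed.

Lemma psq_addC : commutative psq_add.
Proof.
elim/ps_quotW=> x; elim/ps_quotW=> y.
by rewrite !psqE; apply/ps_classP/ps_addC.
Qed.

Lemma psq_add0 : left_id (ps_class (ps_zero S)) psq_add.
Proof. by elim/ps_quotW=> x; rewrite !psqE; apply/ps_classP/ps_add0. Qed.

Lemma psq_addN : left_inverse (ps_class (ps_zero S)) psq_opp psq_add.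
Proof. by elim/ps_quotW=> x; rewrite !psqE; apply/ps_classP/ps_addN. Qed.

HB.instance Definition _ :=
  GRing.isZmodule.Build ps_quot psq_addA psq_addC psq_add0 psq_addN.

Lemma psq_scaleA c d q : psq_scale c (psq_scale d q) = psq_scale (c * d) q.
Proof. by elim/ps_quotW: q => x; rewrite !psqE; apply/ps_classP/ps_scaleA. Qed.

Lemma psq_scale1 : left_id 1 psq_scale.
Proof. by elim/ps_quotW=> x; rewrite !psqE; apply/ps_classP/ps_scale1. Qed.

Lemma psq_scaleDr : right_distributive psq_scale +%R.
Proof.
move=> c; elim/ps_quotW=> x; elim/ps_quotW=> y.
by rewrite /GRing.add /= !psqE; apply/ps_classP/ps_scaleDr.
Qed.

Lemma psq_scaleDl q : {morph psq_scale^~ q : c d / c + d}.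
Proof.
move=> c d; elim/ps_quotW: q => x.
by rewrite [RHS]/GRing.add /= !psqE; apply/ps_classP/ps_scaleDl.
Qed.

HB.instance Definition _ := GRing.Zmodule_isLmodule.Build K ps_quot
  psq_scaleA psq_scale1 psq_scaleDr psq_scaleDl.

Lemma psq_mulA : associative psq_mul.
Proof.
elim/ps_quotW=> x; elim/ps_quotW=> y; elim/ps_quotW=> z.
by rewrite !psqE; apply/ps_classP/ps_mulA.
Qed.

Lemma psq_mulDl : left_distributive psq_mul +%R.
Proof.
elim/ps_quotW=> x; elim/ps_quotW=> y; elim/ps_quotW=> z.
by rewrite /GRing.add /= !psqE; apply/ps_classP/ps_mulDl.
Qed.

Lemma psq_mulDr : right_distributive psq_mul +%R.
Proof.
elim/ps_quotW=> x; elim/ps_quotW=> y; elim/ps_quotW=> z.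
by rewrite /GRing.add /= !psqE; apply/ps_classP/ps_mulDr.
Qed.

Lemma psq_mulZl c p q : psq_mul (c *: p) q = c *: psq_mul p q.
Proof.
elim/ps_quotW: p => x; elim/ps_quotW: q => y.
by rewrite /GRing.scale /= !psqE; apply/ps_classP/ps_mulZl.
Qed.

Lemma psq_mulZr c p q : psq_mul p (c *: q) = c *: psq_mul p q.
Proof.
elim/ps_quotW: p => x; elim/ps_quotW: q => y.
by rewrite /GRing.scale /= !psqE; apply/ps_classP/ps_mulZr.
Qed.

Lemma psq_starK : involutive psq_star.
Proof. by elim/ps_quotW=> x; rewrite !psqE; apply/ps_classP/ps_starK. Qed.

Lemma psq_starD : {morph psq_star : p q / p + q}.
Proof.
elim/ps_quotW=> x; elim/ps_quotW=> y.
by rewrite /GRing.add /= !psqE; apply/ps_classP/ps_starD.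
Qed.

Lemma psq_starM : {morph psq_star : p q / psq_mul p q >-> psq_mul q p}.
Proof.
elim/ps_quotW=> x; elim/ps_quotW=> y.
by rewrite !psqE; apply/ps_classP/ps_starM.
Qed.

Lemma psq_starZ c p : psq_star (c *: p) = conj c *: psq_star p.
Proof.
elim/ps_quotW: p => x.
by rewrite /GRing.scale /= !psqE; apply/ps_classP/ps_starZ.
Qed.

Definition star_quotient : starAlgebra conj :=
  @StarAlgebra K conj ps_quot psq_mul psq_star psq_mulA psq_mulDl psq_mulDr
    psq_mulZl psq_mulZr psq_starK psq_starD psq_starM psq_starZ.

End StarQuotient.

Inductive starTerm (K : fieldType) (X : Type) :=
| TGen of X
| TZero
| TOpp of starTerm K X
| TAdd of starTerm K X & starTerm K X
| TScale of K & starTerm K X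
| TMul of starTerm K X & starTerm K X
| TStar of starTerm K X.
Arguments TGen {K X}.
Arguments TZero {K X}.

HB.instance Definition _ K X := gen_eqMixin (starTerm K X).
HB.instance Definition _ K X := gen_choiceMixin (starTerm K X).

(* The least congruence on terms containing the relations [R] and the axioms of
   (non-unital) *-algebras over [K]. *)
Inductive starCongr (K : fieldType) (conj : fieldInvolution K) (X : Type)
    (R : starTerm K X -> starTerm K X -> Prop) :
    starTerm K X -> starTerm K X -> Prop :=
| sc_rel x y : R x y -> starCongr conj R x y
| sc_refl x : starCongr conj R x x
| sc_sym x y : starCongr conj R x y -> starCongr conj R y x
| sc_trans y x z :
    starCongr conj R x y -> starCongr conj R y z -> starCongr conj R x z
| sc_oppE x x' : starCongr conj R x x' -> starCongr conj R (TOpp x) (TOpp x')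
| sc_addE x x' y y' : starCongr conj R x x' -> starCongr conj R y y' ->
    starCongr conj R (TAdd x y) (TAdd x' y')
| sc_scaleE c x x' : starCongr conj R x x' ->
    starCongr conj R (TScale c x) (TScale c x')
| sc_mulE x x' y y' : starCongr conj R x x' -> starCongr conj R y y' ->
    starCongr conj R (TMul x y) (TMul x' y')
| sc_starE x x' : starCongr conj R x x' -> starCongr conj R (TStar x) (TStar x')
| sc_addA x y z : starCongr conj R (TAdd x (TAdd y z)) (TAdd (TAdd x y) z)
| sc_addC x y : starCongr conj R (TAdd x y) (TAdd y x)
| sc_add0 x : starCongr conj R (TAdd TZero x) x
| sc_addN x : starCongr conj R (TAdd (TOpp x) x) TZero
| sc_scaleA c d x :
    starCongr conj R (TScale c (TScale d x)) (TScale (c * d) x)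
| sc_scale1 x : starCongr conj R (TScale 1 x) x
| sc_scaleDr c x y :
    starCongr conj R (TScale c (TAdd x y)) (TAdd (TScale c x) (TScale c y))
| sc_scaleDl c d x :
    starCongr conj R (TScale (c + d) x) (TAdd (TScale c x) (TScale d x))
| sc_mulA x y z : starCongr conj R (TMul x (TMul y z)) (TMul (TMul x y) z)
| sc_mulDl x y z :
    starCongr conj R (TMul (TAdd x y) z) (TAdd (TMul x z) (TMul y z))
| sc_mulDr x y z :
    starCongr conj R (TMul x (TAdd y z)) (TAdd (TMul x y) (TMul x z))
| sc_mulZl c x y :
    starCongr conj R (TMul (TScale c x) y) (TScale c (TMul x y))
| sc_mulZr c x y :
    starCongr conj R (TMul x (TScale c y)) (TScale c (TMul x y))
| sc_starK x : starCongr conj R (TStar (TStar x)) x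
| sc_starD x y :
    starCongr conj R (TStar (TAdd x y)) (TAdd (TStar x) (TStar y))
| sc_starM x y :
    starCongr conj R (TStar (TMul x y)) (TMul (TStar y) (TStar x))
| sc_starZ c x :
    starCongr conj R (TStar (TScale c x)) (TScale (conj c) (TStar x)).

Section Presentation.
Variables (K : fieldType) (conj : fieldInvolution K) (X : Type).
Variable R : starTerm K X -> starTerm K X -> Prop.

Definition presented_pre : preStarAlgebra conj (starTerm K X) :=
  @PreStarAlgebra K conj (starTerm K X) (starCongr conj R)
    TZero (@TOpp K X) (@TAdd K X) (@TScale K X) (@TMul K X) (@TStar K X)
    (@sc_refl _ _ _ R) (@sc_sym _ _ _ R) (@sc_trans _ _ _ R)
    (@sc_oppE _ _ _ R) (@sc_addE _ _ _ R) (@sc_scaleE _ _ _ R)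
    (@sc_mulE _ _ _ R) (@sc_starE _ _ _ R)
    (@sc_addA _ _ _ R) (@sc_addC _ _ _ R) (@sc_add0 _ _ _ R)
    (@sc_addN _ _ _ R) (@sc_scaleA _ _ _ R) (@sc_scale1 _ _ _ R)
    (@sc_scaleDr _ _ _ R) (@sc_scaleDl _ _ _ R)
    (@sc_mulA _ _ _ R) (@sc_mulDl _ _ _ R) (@sc_mulDr _ _ _ R)
    (@sc_mulZl _ _ _ R) (@sc_mulZr _ _ _ R)
    (@sc_starK _ _ _ R) (@sc_starD _ _ _ R) (@sc_starM _ _ _ R)
    (@sc_starZ _ _ _ R).

Definition presented_algebra : starAlgebra conj := star_quotient presented_pre.

Definition presented_gen (x : X) : presented_algebra :=
  ps_class presented_pre (TGen x).

End Presentation.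

Record starIdeal (K : fieldType) (conj : fieldInvolution K)
    (A : starAlgebra conj) := StarIdeal {
  si_mem : A -> Prop;
  si_zero : si_mem 0;
  si_add : forall x y, si_mem x -> si_mem y -> si_mem (x + y);
  si_scale : forall c x, si_mem x -> si_mem (c *: x);
  si_mull : forall a x, si_mem x -> si_mem (sa_mul a x);
  si_mulr : forall a x, si_mem x -> si_mem (sa_mul x a);
  si_star : forall x, si_mem x -> si_mem (sa_star x) }.

Section IdealQuotient.
Variables (K : fieldType) (conj : fieldInvolution K) (A : starAlgebra conj).
Variable I : starIdeal A.

Definition idealq_eqv (x y : A) : Prop := si_mem I (x - y).

Lemma idealq_eq x y : x = y -> idealq_eqv x y.
Proof. by move=> ->; rewrite /idealq_eqv subrr; apply: si_zero. Qed.

Lemma idealq_sym x y : idealq_eqv x y -> idealq_eqv y x.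
Proof.
by move=> /(si_scale (-1)); rewrite /idealq_eqv scaleN1r opprB.
Qed.

Lemma idealq_trans y x z : idealq_eqv x y -> idealq_eqv y z -> idealq_eqv x z.
Proof.
by move=> xy yz; have := si_add xy yz; rewrite /idealq_eqv addrA subrK.
Qed.

Lemma idealq_add x x' y y' :
  idealq_eqv x x' -> idealq_eqv y y' -> idealq_eqv (x + y) (x' + y').
Proof.
by move=> xx yy; have := si_add xx yy; rewrite /idealq_eqv opprD addrACA.
Qed.

Lemma idealq_scale c x x' : idealq_eqv x x' -> idealq_eqv (c *: x) (c *: x').
Proof. by move=> /(si_scale c); rewrite /idealq_eqv scalerBr. Qed.

Lemma idealq_opp x x' : idealq_eqv x x' -> idealq_eqv (- x) (- x').
Proof. by move=> /(idealq_scale (-1)); rewrite !scaleN1r. Qed.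

Lemma idealq_mul x x' y y' : idealq_eqv x x' -> idealq_eqv y y' ->
  idealq_eqv (sa_mul x y) (sa_mul x' y').
Proof.
move=> xx yy; apply: (@idealq_trans (sa_mul x' y)).
  have := si_mulr y xx.
  by rewrite /idealq_eqv sa_mulDl -scaleN1r sa_mulZl scaleN1r.
have := si_mull x' yy.
by rewrite /idealq_eqv sa_mulDr -scaleN1r sa_mulZr scaleN1r.
Qed.

Lemma idealq_star x x' :
  idealq_eqv x x' -> idealq_eqv (sa_star x) (sa_star x').
Proof.
move=> /si_star; rewrite /idealq_eqv sa_starD -scaleN1r sa_starZ.
by rewrite rmorphN1 scaleN1r.
Qed.

Definition idealq_pre : preStarAlgebra conj A.
Proof.
refine (@PreStarAlgebra K conj A idealq_eqv 0 -%R +%R *:%R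
  (@sa_mul _ _ A) (@sa_star _ _ A) _ idealq_sym idealq_trans idealq_opp
  idealq_add idealq_scale idealq_mul idealq_star _ _ _ _ _ _ _ _ _ _ _ _ _ _
  _ _ _); intros; apply: idealq_eq => //.
- exact: addrA.
- exact: addrC.
- exact: add0r.
- exact: addNr.
- exact: scalerA.
- exact: scale1r.
- exact: scalerDr.
- exact: scalerDl.
- exact: sa_mulA.
- exact: sa_mulDl.
- exact: sa_mulDr.
- exact: sa_mulZl.
- exact: sa_mulZr.
- exact: sa_starK.
- exact: sa_starD.
- exact: sa_starM.
- exact: sa_starZ.
Defined.

Definition ideal_quotient : starAlgebra conj := star_quotient idealq_pre.

End IdealQuotient.

Section GeneratedIdeal.
Variables (K : fieldType) (conj : fieldInvolution K) (A : starAlgebra conj).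

Inductive in_ideal_gen (S : A -> Prop) : A -> Prop :=
| ig_mem x : S x -> in_ideal_gen S x
| ig_zero : in_ideal_gen S 0
| ig_add x y : in_ideal_gen S x -> in_ideal_gen S y -> in_ideal_gen S (x + y)
| ig_scale c x : in_ideal_gen S x -> in_ideal_gen S (c *: x)
| ig_mull a x : in_ideal_gen S x -> in_ideal_gen S (sa_mul a x)
| ig_mulr a x : in_ideal_gen S x -> in_ideal_gen S (sa_mul x a).

Lemma in_ideal_gen_star (S : A -> Prop) :
    (forall x, S x -> in_ideal_gen S (sa_star x)) ->
  forall x, in_ideal_gen S x -> in_ideal_gen S (sa_star x).
Proof.
move=> Sstar x.
elim=> {x} [x Sx||x y _ IHx _ IHy|c x _ IH|a x _ IH|a x _ IH].
- exact: Sstar.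
- have -> : sa_star (0 : A) = 0.
    by rewrite -[X in sa_star X](scale0r (0 : A)) sa_starZ rmorph0 scale0r.
  exact: ig_zero.
- by rewrite sa_starD; apply: ig_add.
- by rewrite sa_starZ; apply: ig_scale.
- by rewrite sa_starM; apply: ig_mulr.
- by rewrite sa_starM; apply: ig_mull.
Qed.

Definition generated_ideal (S : A -> Prop)
    (Sstar : forall x, S x -> in_ideal_gen S (sa_star x)) : starIdeal A :=
  @StarIdeal K conj A (in_ideal_gen S) (ig_zero S) (@ig_add S) (@ig_scale S)
    (@ig_mull S) (@ig_mulr S) (in_ideal_gen_star Sstar).

End GeneratedIdeal.

Definition sa_comm (K : fieldType) (conj : fieldInvolution K)
    (A : starAlgebra conj) (x y : A) : A := sa_mul x y - sa_mul y x.

Lemma sa_comm_star (K : fieldType) (conj : fieldInvolution K)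
    (A : starAlgebra conj) (x y : A) :
  sa_star (sa_comm x y) = sa_comm (sa_star y) (sa_star x).
Proof.
by rewrite /sa_comm sa_starD -scaleN1r sa_starZ rmorphN1 scaleN1r !sa_starM.
Qed.

Record finWeightedGraph := FinWeightedGraph {
  gvert : finType;
  gedge : finType;
  gsrc : gedge -> gvert;
  grng : gedge -> gvert;
  gweight : gedge -> nat;
  gweight_gt0 : forall e, (0 < gweight e)%N;
  gno_isolated : forall v, (exists e, gsrc e = v) \/ (exists e, grng e = v) }.

(* This is 0 on sinks. *)
Definition vweight (E : finWeightedGraph) (v : gvert E) : nat :=
  \max_(e : gedge E | gsrc e == v) gweight e.

(* The symbols e_i, with 1 <= i <= w(e) shifted to 0 <= i < w(e). *)
Definition wsym (E : finWeightedGraph) : Type :=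
  {e : gedge E & 'I_(gweight e)}.
HB.instance Definition _ E := Finite.on (wsym E).

Definition wsymb (E : finWeightedGraph) (e : gedge E) (i : 'I_(gweight e)) :
  wsym E := Tagged (fun e => 'I_(gweight e)) i.
Definition wedge E (x : wsym E) : gedge E := tag x.
Definition windex E (x : wsym E) : nat := tagged x.

Section LeavittPathAlgebras.
Variables (K : fieldType) (conj : fieldInvolution K) (E : finWeightedGraph).

Local Notation term := (starTerm K (gvert E + wsym E)%type).

Definition tvert (v : gvert E) : term := TGen (inl v).
Definition tsym (x : wsym E) : term := TGen (inr x).

Inductive L1_rel : term -> term -> Prop :=
| L1_vertM u v :
    L1_rel (TMul (tvert u) (tvert v)) (if u == v then tvert u else TZero)
| L1_vert_star v : L1_rel (tvert v) (TStar (tvert v))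
| L1_src x : L1_rel (TMul (tvert (gsrc (wedge x))) (tsym x)) (tsym x)
| L1_rng x : L1_rel (tsym x) (TMul (tsym x) (tvert (grng (wedge x))))
| L1_orth_index (e : gedge E) (i j : 'I_(gweight e)) : i <> j ->
    L1_rel (TMul (tsym (wsymb i)) (TStar (tsym (wsymb j)))) TZero
| L1_orth_edge (e f : gedge E) (i : 'I_(gweight e)) (j : 'I_(gweight f)) :
    gsrc e = gsrc f -> e <> f -> i = j :> nat ->
    L1_rel (TMul (TStar (tsym (wsymb i))) (tsym (wsymb j))) TZero
| L1_sum_src (v : gvert E) (i : nat) : (i < vweight v)%N ->
    L1_rel (\big[@TAdd _ _/TZero]_(x : wsym E |
              (gsrc (wedge x) == v) && (windex x == i))
              TMul (tsym x) (TStar (tsym x)))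
           (tvert v)
| L1_sum_rng (e : gedge E) :
    L1_rel (\big[@TAdd _ _/TZero]_(i < gweight e)
              TMul (TStar (tsym (wsymb i))) (tsym (wsymb i)))
           (tvert (grng e)).

Definition L1 : starAlgebra conj := presented_algebra conj L1_rel.

Definition L1_sym (x : wsym E) : L1 := presented_gen conj L1_rel (inr x).

Inductive in_U : L1 -> Prop :=
| U_sym x : in_U (L1_sym x)
| U_mul a b : in_U a -> in_U b -> in_U (sa_mul a b)
| U_star a : in_U a -> in_U (sa_star a).

Definition is_commUU (z : L1) : Prop :=
  exists u u' : L1, [/\ in_U u, in_U u' &
    z = sa_comm (sa_mul u (sa_star u)) (sa_mul u' (sa_star u'))].

Lemma is_commUU_star z : is_commUU z -> in_ideal_gen is_commUU (sa_star z).
Proof.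
move=> [u [u' [Uu Uu' ->]]]; apply: ig_mem; exists u', u; split=> //.
by rewrite sa_comm_star !sa_starM !sa_starK.
Qed.

Definition Jab : starIdeal L1 := generated_ideal is_commUU_star.

Definition Lab : starAlgebra conj := ideal_quotient Jab.

End LeavittPathAlgebras.

(* [f] restricts to a homeomorphism from [A] onto [B]; its values outside [A]
   are irrelevant. *)
Definition homeo_on (T U : topologicalType) (A : set T) (B : set U)
    (f : T -> U) : Prop :=
  exists g : U -> T,
    [/\ forall x, A x -> B (f x), forall y, B y -> A (g y),
        forall x, A x -> g (f x) = x & forall y, B y -> f (g y) = y] /\
    ({within A, continuous f} /\ {within B, continuous g}).

Definition disjoint_union (T I : Type) (A : set T) (D : set I)
    (F : I -> set T) : Prop :=
  trivIset D F /\ A = \bigcup_(i in D) F i.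

(* [ds_src x] is H_{alpha^i(e)} and [ds_rng x] is H_{alpha^e(i)}, x = e_i. *)
Record dynSystem (E : finWeightedGraph) := DynSystem {
  ds_space :> topologicalType;
  ds_compact : compact [set: ds_space];
  ds_hausdorff : hausdorff_space ds_space;
  ds_vert : gvert E -> set ds_space;
  ds_src : wsym E -> set ds_space;
  ds_rng : wsym E -> set ds_space;
  ds_theta : wsym E -> ds_space -> ds_space;
  ds_vert_clopen : forall v, clopen (ds_vert v);
  ds_src_clopen : forall x, clopen (ds_src x);
  ds_rng_clopen : forall x, clopen (ds_rng x);
  ds_vert_part : disjoint_union [set: ds_space] [set: gvert E] ds_vert;
  ds_src_part : forall (v : gvert E) (i : nat), (i < vweight v)%N ->
    disjoint_union (ds_vert v)
      [set x | gsrc (wedge x) = v /\ windex x = i] ds_src;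
  ds_rng_part : forall e : gedge E,
    disjoint_union (ds_vert (grng e))
      [set: 'I_(gweight e)] (fun i => ds_rng (wsymb i));
  ds_theta_homeo : forall x, homeo_on (ds_rng x) (ds_src x) (ds_theta x) }.

Definition equivariant (E : finWeightedGraph) (D D' : dynSystem E)
    (f : D -> D') : Prop :=
  [/\ forall v y, ds_vert v y -> ds_vert v (f y),
      forall x y, ds_src x y -> ds_src x (f y),
      forall x y, ds_rng x y -> ds_rng x (f y) &
      forall x y, ds_rng x y -> ds_theta x (f y) = f (ds_theta x y)].

Definition universal_system (E : finWeightedGraph) (D : dynSystem E) : Prop :=
  forall D' : dynSystem E,
    exists! f : D' -> D, continuous f /\ equivariant f.

(* [pa_act g] is meant as a map from [pa_dom g^-1] to [pa_dom g]; its values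
   outside [pa_dom g^-1] are irrelevant. *)
Record partialAction (G : groupType) (T : topologicalType) := PartialAction {
  pa_dom : G -> set T;
  pa_act : G -> T -> T;
  pa_clopen : forall g, clopen (pa_dom g);
  pa_homeo : forall g, homeo_on (pa_dom g^-1%g) (pa_dom g) (pa_act g);
  pa_dom1 : pa_dom 1%g = [set: T];
  pa_act1 : forall x, pa_act 1%g x = x;
  pa_actM : forall g h x, pa_dom h^-1%g x -> pa_dom g^-1%g (pa_act h x) ->
    pa_dom (g * h)^-1%g x /\ pa_act (g * h)%g x = pa_act g (pa_act h x) }.

Section CrossedProduct.
Variables (K : fieldType) (conj : fieldInvolution K).
Variables (G : groupType) (T : topologicalType) (th : partialAction G T).

Local Notation dom := (pa_dom th).
Local Notation act := (pa_act th).

(* The isomorphism C_K(dom g^-1) -> C_K(dom g), f |-> f \o th_{g^-1}; functions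
   on a clopen subset are identified with their extensions by 0. *)
Definition pa_fun (g : G) (f : T -> K) : T -> K :=
  fun x => if x \in dom g then f (act g^-1%g x) else 0.

(* The family [a] stands for the sum of the (a g) delta_g. *)
Definition is_crossed (a : G -> T -> K^o) : Prop :=
  [/\ finite_set [set g | a g <> 0],
      forall g, continuous (a g : T -> discrete_topology K) &
      forall g x, ~ dom g x -> a g x = 0].

Definition crossed_mul (a b : G -> T -> K^o) : G -> T -> K^o := fun k x =>
  \sum_(g \in [set: G])
    pa_fun g (fun y => pa_fun g^-1%g (a g) y * b (g^-1 * k)%g y) x.

Definition crossed_star (a : G -> T -> K^o) : G -> T -> K^o := fun k =>
  pa_fun k (fun y => conj (a k^-1%g y)).

Lemma pa_domE g x : dom g^-1%g x -> dom g (act g x).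
Proof. by case: (pa_homeo th g) => ? [[+ _ _ _] _]; apply. Qed.

Lemma pa_actK g x : dom g^-1%g x -> act g^-1%g (act g x) = x.
Proof.
move=> gx; have [//||_] := @pa_actM _ _ th g^-1%g g x.
  by rewrite invgK; apply: pa_domE.
by rewrite mulVg pa_act1 => <-.
Qed.

Lemma pa_actVK g x : dom g x -> act g (act g^-1%g x) = x.
Proof. by move=> gx; rewrite -{1}[g]invgK pa_actK ?invgK. Qed.

Lemma pa_domVE g x : dom g x -> dom g^-1%g (act g^-1%g x).
Proof. by move=> gx; apply: pa_domE; rewrite invgK. Qed.

Lemma loc_constP (f : T -> K) :
  continuous (f : T -> discrete_topology K) <->
  forall x, \forall y \near x, f y = f x.
Proof.
split=> fc x; first exact: (fc x _ (discrete_set1 (f x : discrete_topology K))).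
apply: (iffRL (@discrete_cvg (discrete_topology K) (f @ x) (f x) _)).
exact: fc.
Qed.

Lemma pa_funE g f x : dom g x -> pa_fun g f x = f (act g^-1%g x).
Proof. by move=> gx; rewrite /pa_fun mem_set. Qed.

Lemma pa_fun0 g f x : ~ dom g x -> pa_fun g f x = 0.
Proof. by move=> gx; rewrite /pa_fun memNset. Qed.

Lemma pa_fun_cont g (f : T -> K) :
  continuous (f : T -> discrete_topology K) ->
  continuous (pa_fun g f : T -> discrete_topology K).
Proof.
move=> /loc_constP fc; apply/loc_constP => x.
have [og cg] := pa_clopen th g.
have [xg|xg] := pselect (dom g x); last first.
  have : \forall y \near x, (~` dom g) y.
    by apply: open_nbhs_nbhs; split=> //; apply: closed_openC.
  by apply: filterS => y /= yg; rewrite !pa_fun0.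
have : {within dom g, continuous (act g^-1%g)}.
  by case: (pa_homeo th g^-1%g) => ? [_ []]; rewrite invgK.
rewrite continuous_open_subspace // => /(_ x (mem_set xg)) /(_ _ (fc _)).
have : \forall y \near x, dom g y by apply: open_nbhs_nbhs.
by apply: filterS2 => y yg /= fy; rewrite !pa_funE.
Qed.

Lemma is_crossed0 : is_crossed (0 : G -> T -> K^o).
Proof.
split=> // [|g]; last by apply/loc_constP => x; apply: nearW.
have -> : [set g | (0 : G -> T -> K^o) g <> 0] = set0; last exact: finite_set0.
by apply/seteqP; split=> g //=.
Qed.

Lemma crossed_linE (c : K) (a b : G -> T -> K^o) g x :
  (c *: a + b) g x = c * a g x + b g x.
Proof. by []. Qed.

Lemma is_crossed_lin c a b :
  is_crossed a -> is_crossed b -> is_crossed (c *: a + b).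
Proof.
move=> [fa ca da] [fb cb db]; split=> [|g|g x xg].
- apply: (@sub_finite_set _ _ ([set g | a g <> 0] `|` [set g | b g <> 0])).
    move=> g /=; apply: contra_notP => /not_orP[/contrapT ag /contrapT bg].
    by apply/funext => x; rewrite crossed_linE ag bg mulr0 addr0.
  by rewrite finite_setU.
- apply/loc_constP => x; have /loc_constP/(_ x) := ca g.
  have /loc_constP/(_ x) := cb g.
  by apply: filterS2 => y by_ ay; rewrite !crossed_linE ay by_.
- by rewrite crossed_linE da // db // mulr0 addr0.
Qed.

Lemma crossed_mulE a b : is_crossed a -> forall k x,
  crossed_mul a b k x =
  \sum_(g \in [set: G]) (a g x : K) * b (g^-1 * k)%g (act g^-1%g x).
Proof.
move=> [_ _ da] k x; apply: eq_fsbigr => g _.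
have [xg|xg] := pselect (dom g x); last by rewrite pa_fun0 // da // mul0r.
by rewrite pa_funE // pa_funE ?invgK ?pa_actVK //; apply: pa_domVE.
Qed.

Lemma is_crossed_supp a : is_crossed a ->
  exists A : {fset G}, forall g, g \notin A -> forall x, a g x = 0.
Proof.
move=> [/finite_fsetP[A eA] _ _]; exists A => g gA x.
suff -> : a g = 0 by [].
apply: contrapT => ag; have : [set` A] g by rewrite -eA.
by move=> /= gA'; rewrite gA' in gA.
Qed.

Lemma crossed_mul_seq a b (A : {fset G}) : is_crossed a ->
    (forall g, g \notin A -> forall x, a g x = 0) -> forall k x,
  crossed_mul a b k x =
  \sum_(g <- A) (a g x : K) * b (g^-1 * k)%g (act g^-1%g x).
Proof.
move=> ac aA k x; rewrite crossed_mulE //; apply: fsbigTE => g gA.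
by rewrite aA // mul0r.
Qed.

Lemma is_crossed_mul a b :
  is_crossed a -> is_crossed b -> is_crossed (crossed_mul a b).
Proof.
move=> ac bc; have [A aA] := is_crossed_supp ac.
have [B bB] := is_crossed_supp bc.
have [_ ca da] := ac; have [_ cb db] := bc.
split=> [|k|k x xk].
- apply: (@sub_finite_set _ _ [set` [fset (g * h)%g | g in A, h in B]%fset]).
    move=> k /=; apply: contra_notT => kAB; apply/funext => x.
    rewrite (crossed_mul_seq _ ac aA) big_seq big1 // => g gA.
    rewrite bB ?mulr0 //; apply: contra kAB => gB.
    by apply/imfset2P; exists g => //; exists (g^-1 * k)%g; rewrite ?mulVKg.
  exact: finite_fset.
- apply/loc_constP => x.
  have : \forall y \near x, forall g, g \in A ->
      pa_fun g (fun y => pa_fun g^-1%g (a g) y * b (g^-1 * k)%g y) y =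
      pa_fun g (fun y => pa_fun g^-1%g (a g) y * b (g^-1 * k)%g y) x.
    have : forall g, \forall y \near x,
      pa_fun g (fun y => pa_fun g^-1%g (a g) y * b (g^-1 * k)%g y) y =
      pa_fun g (fun y => pa_fun g^-1%g (a g) y * b (g^-1 * k)%g y) x.
      move=> g; move: x; apply/loc_constP/pa_fun_cont/loc_constP => x.
      have /loc_constP/(_ x) aP := pa_fun_cont (g := g^-1%g) (ca g).
      have /loc_constP/(_ x) bP := cb (g^-1 * k)%g.
      by move: aP bP; apply: filterS2 => y -> ->.
    move=> near1.
    suff {ac aA} : forall s : seq G, \forall y \near x, forall g, g \in s ->
      pa_fun g (fun y => pa_fun g^-1%g (a g) y * b (g^-1 * k)%g y) y =
      pa_fun g (fun y => pa_fun g^-1%g (a g) y * b (g^-1 * k)%g y) x.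
      by move=> /(_ (enum_fset A)).
    elim=> [|g s IH]; first by apply: nearW.
    apply: filterS2 (near1 g) IH => y yg ys h; rewrite inE => /orP[/eqP -> //|].
    exact: ys.
  apply: filterS => y yE; rewrite /crossed_mul.
  have supp z g : g \notin A ->
      pa_fun g (fun y => pa_fun g^-1%g (a g) y * b (g^-1 * k)%g y) z = 0.
    move=> gA; rewrite /pa_fun; case: ifP => // _; case: ifP => _.
      by rewrite aA // mul0r.
    by rewrite mul0r.
  rewrite !(fsbigTE A); try exact: supp.
  by apply: eq_big_seq => g gA; apply: yE.
- rewrite (crossed_mul_seq _ ac aA) big1 // => g _.
  have [xg|xg] := pselect (dom g x); last by rewrite da // mul0r.
  have [yg|yg] := pselect (dom (g^-1 * k)%g (act g^-1%g x)); last first.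
    by rewrite db // mulr0.
  case: xk; have := @pa_actM _ _ th (k^-1 * g)%g g^-1%g x.
  by rewrite invgK -mulgA mulgV mulg1 invgK invgM invgK => /(_ xg yg)[].
Qed.

Lemma is_crossed_star a : is_crossed a -> is_crossed (crossed_star a).
Proof.
move=> ac; have [A aA] := is_crossed_supp ac; have [_ ca _] := ac.
split=> [|k|k x xk].
- apply: (@sub_finite_set _ _ [set` [fset g^-1%g | g in A]%fset]).
    move=> k /=; apply: contra_notT => kA; apply/funext => x.
    rewrite /crossed_star /pa_fun; case: ifP => // _.
    rewrite aA ?rmorph0 //; apply: contra kA => kA.
    by apply/imfsetP; exists k^-1%g; rewrite ?invgK.
  exact: finite_fset.
- apply/pa_fun_cont/loc_constP => x; have /loc_constP/(_ x) := ca k^-1%g.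
  by apply: filterS => y ->.
- exact: pa_fun0.
Qed.

Lemma crossed_mulA a b c : is_crossed a -> is_crossed b -> is_crossed c ->
  crossed_mul a (crossed_mul b c) = crossed_mul (crossed_mul a b) c.
Proof.
move=> ac bc cc; have [A aA] := is_crossed_supp ac.
have [B bB] := is_crossed_supp bc; have abc := is_crossed_mul ac bc.
have [_ _ da] := ac; have [_ _ db] := bc.
apply/funext => k; apply/funext => x.
pose H := [fset (g * h)%g | g in A, h in B]%fset.
have abH h : h \notin H -> forall g y, g \in A -> b (g^-1 * h)%g y = 0.
  move=> hH g y gA; apply: bB; apply: contra hH => hB.
  by apply/imfset2P; exists g => //; exists (g^-1 * h)%g; rewrite ?mulVKg.
rewrite (crossed_mul_seq _ ac aA) (@crossed_mul_seq _ _ H) //; last first.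
  move=> h hH y; rewrite (crossed_mul_seq _ ac aA) big_seq big1 // => g gA.
  by rewrite (abH h) // mulr0.
under [RHS]eq_bigr do rewrite (crossed_mul_seq _ ac aA) mulr_suml.
rewrite exchange_big /=; apply: eq_big_seq => g gA.
rewrite crossed_mulE // mulr_fsumr.
rewrite -(fsbigTE H (fun h => a g x * b (g^-1 * h)%g (act g^-1%g x)
           * c (h^-1 * k)%g (act h^-1%g x))); last first.
  by move=> h hH; rewrite (abH h) // mulr0 mul0r.
rewrite [RHS](reindex_fsbigT (fun m => (g * m)%g)); last first.
  by exists (fun m => (g^-1 * m)%g) => m; rewrite ?mulKg ?mulVKg.
apply: eq_fsbigr => m _; rewrite mulKg mulrA.
have [xg|xg] := pselect (dom g x); last by rewrite da // !mul0r.
have [yg|yg] := pselect (dom m (act g^-1%g x)); last first.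
  by rewrite db // mulr0 !mul0r.
have := @pa_actM _ _ th m^-1%g g^-1%g x; rewrite !invgK => /(_ xg yg)[_].
by rewrite -invgM => ->; rewrite invgM mulgA.
Qed.

Lemma crossed_mul_linl c a b d : is_crossed a -> is_crossed b ->
  crossed_mul (c *: a + b) d = c *: crossed_mul a d + crossed_mul b d.
Proof.
move=> ac bc; have abc := is_crossed_lin c ac bc.
have [A aA] := is_crossed_supp ac; have [B bB] := is_crossed_supp bc.
have aAB g : g \notin (A `|` B)%fset -> forall x, a g x = 0.
  by rewrite inE negb_or => /andP[/aA].
have bAB g : g \notin (A `|` B)%fset -> forall x, b g x = 0.
  by rewrite inE negb_or => /andP[_ /bB].
apply/funext => k; apply/funext => x.
rewrite crossed_linE (crossed_mul_seq _ ac aAB) (crossed_mul_seq _ bc bAB).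
rewrite (@crossed_mul_seq _ _ (A `|` B)%fset) //; last first.
  by move=> g gAB y; rewrite crossed_linE aAB // bAB // mulr0 addr0.
rewrite mulr_sumr -big_split /=; apply: eq_bigr => g _.
by rewrite crossed_linE mulrDl mulrA.
Qed.

Lemma crossed_mul_linr c a b d : is_crossed d ->
  crossed_mul d (c *: a + b) = c *: crossed_mul d a + crossed_mul d b.
Proof.
move=> dc; have [D dD] := is_crossed_supp dc.
apply/funext => k; apply/funext => x.
rewrite crossed_linE !(crossed_mul_seq _ dc dD).
rewrite mulr_sumr -big_split /=; apply: eq_bigr => g _.
by rewrite crossed_linE mulrDr mulrCA.
Qed.

Lemma crossed_starK a : is_crossed a -> crossed_star (crossed_star a) = a.
Proof.
move=> [_ _ da]; apply/funext => k; apply/funext => x.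
have [xk|xk] := pselect (dom k x); last by rewrite /crossed_star pa_fun0 // da.
rewrite /crossed_star pa_funE // pa_funE; last exact: pa_domVE.
by rewrite involK !invgK pa_actVK.
Qed.

Lemma crossed_star_lin c a b :
  crossed_star (c *: a + b) = conj c *: crossed_star a + crossed_star b.
Proof.
apply/funext => k; apply/funext => x.
rewrite crossed_linE /crossed_star.
have [xk|xk] := pselect (dom k x); last by rewrite !pa_fun0 // mulr0 addr0.
by rewrite !pa_funE // -rmorphM -rmorphD.
Qed.

Lemma crossed_starM a b : is_crossed a -> is_crossed b ->
  crossed_star (crossed_mul a b) =
  crossed_mul (crossed_star b) (crossed_star a).
Proof.
move=> ac bc; apply/funext => k; apply/funext => x.
have [_ _ da] := ac; have [_ _ db] := bc.
have [A aA] := is_crossed_supp ac.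
rewrite (crossed_mulE _ (is_crossed_star bc)).
transitivity (\sum_(g \in [set: G]) pa_fun k
    (fun y => conj (a g y) * conj (b (g^-1 * k^-1)%g (act g^-1%g y))) x).
  have [xk|xk] := pselect (dom k x); last first.
    by rewrite /crossed_star pa_fun0 // fsbig1 // => g _; rewrite pa_fun0.
  rewrite /crossed_star pa_funE // (crossed_mul_seq _ ac aA) rmorph_sum /=.
  rewrite (fsbigTE A); last first.
    by move=> g gA; rewrite pa_funE // aA // rmorph0 mul0r.
  by apply: eq_bigr => g _; rewrite pa_funE // rmorphM.
rewrite (reindex_fsbigT (fun h => (k^-1 * h)%g)); last first.
  by exists (fun m => (k * m)%g) => m; rewrite ?mulKg ?mulVKg.
apply: eq_fsbigr => h _.
rewrite /crossed_star !invgM invgK -mulgA mulgV mulg1.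
have [xh|xh] := pselect (dom h x /\ dom (h^-1 * k)%g (act h^-1%g x)).
  case: xh => xh zh; rewrite (pa_funE _ xh) (pa_funE _ zh) invgM invgK.
  have := @pa_actM _ _ th (k^-1 * h)%g h^-1%g x.
  rewrite invgK -mulgA mulgV mulg1 invgK invgM invgK => /(_ xh zh)[xk E].
  rewrite pa_funE // E mulrC; congr (_ * _); congr (conj (b _ _)).
  by have := pa_actVK zh; rewrite invgM invgK.
rewrite [RHS](_ : _ = 0); last first.
  have [xh'|xh'] := pselect (dom h x); last by rewrite pa_fun0 // mul0r.
  have zh : ~ dom (h^-1 * k)%g (act h^-1%g x) by move=> zh; apply: xh.
  by rewrite (pa_fun0 _ zh) mulr0.
have [xk|xk] := pselect (dom k x); last by rewrite pa_fun0.
rewrite pa_funE //.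
have [yk|yk] := pselect (dom (k^-1 * h)%g (act k^-1%g x)); last first.
  by rewrite da // rmorph0 mul0r.
case: xh; have := @pa_actM _ _ th (h^-1 * k)%g k^-1%g x.
rewrite invgK -mulgA mulgV mulg1 invgK invgM invgK => /(_ xk yk)[xh E].
by split=> //; rewrite E; have := pa_domVE yk; rewrite invgM invgK.
Qed.

Definition crossed_pred : {pred G -> T -> K^o} := fun a => `[< is_crossed a >].

Lemma crossed_pred_submod : submod_closed crossed_pred.
Proof.
split=> [|c a b /asboolP ac /asboolP bc]; first exact/asboolP/is_crossed0.
exact/asboolP/is_crossed_lin.
Qed.

HB.instance Definition _ :=
  GRing.isSubmodClosed.Build K (G -> T -> K^o) crossed_pred crossed_pred_submod.

Record crossed_type :=
  Crossed { crossed_val :> G -> T -> K^o; _ : crossed_val \in crossed_pred }.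

HB.instance Definition _ := [isSub for crossed_val].
HB.instance Definition _ := [Choice of crossed_type by <:].
HB.instance Definition _ := [SubChoice_isSubLmodule of crossed_type by <:].

Lemma crossedP (a : crossed_type) : is_crossed a.
Proof. by case: a => a ac; apply/asboolP. Qed.

Definition crossedM (a b : crossed_type) : crossed_type :=
  Crossed (asboolT (is_crossed_mul (crossedP a) (crossedP b))).

Definition crossedS (a : crossed_type) : crossed_type :=
  Crossed (asboolT (is_crossed_star (crossedP a))).

Definition crossed_product : starAlgebra conj.
Proof.
refine (@StarAlgebra K conj crossed_type crossedM crossedS
  _ _ _ _ _ _ _ _ _).
- by move=> a b c; apply: val_inj; apply: crossed_mulA; apply: crossedP.
- move=> a b c; apply: val_inj.
  have := crossed_mul_linl 1 c (crossedP a) (crossedP b).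
  by rewrite !scale1r; apply.
- move=> a b c; apply: val_inj.
  have := crossed_mul_linr 1 b c (crossedP a).
  by rewrite !scale1r; apply.
- move=> c a b; apply: val_inj.
  have := crossed_mul_linl c b (crossedP a) is_crossed0.
  have := crossed_mul_linl 1 b is_crossed0 is_crossed0.
  rewrite !scale1r addr0 -[LHS]addr0 => /addrI <-.
  by rewrite !addr0; apply.
- move=> c a b; apply: val_inj.
  have := crossed_mul_linr c b 0 (crossedP a).
  have := crossed_mul_linr 1 0 0 (crossedP a).
  rewrite !scale1r addr0 -[LHS]addr0 => /addrI <-.
  by rewrite !addr0; apply.
- by move=> a; apply: val_inj; apply: crossed_starK; apply: crossedP.
- move=> a b; apply: val_inj.
  by have := crossed_star_lin 1 a b; rewrite rmorph1 !scale1r; apply.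
- by move=> a b; apply: val_inj; apply: crossed_starM; apply: crossedP.
- move=> c a; apply: val_inj.
  have := crossed_star_lin c a 0; have := crossed_star_lin 1 0 0.
  rewrite rmorph1 !scale1r addr0 -[LHS]addr0 => /addrI <-.
  by rewrite !addr0; apply.
Defined.

End CrossedProduct.

(* Elements of the free group are reduced words; the product concatenates and
   cancels. *)
Section FreeGroup.
Variable X : choiceType.

(* The letter (x, true) stands for x and (x, false) for its inverse. *)
Definition fletter : Type := (X * bool)%type.
HB.instance Definition _ := Choice.on fletter.

Definition linv (l : fletter) : fletter := (l.1, ~~ l.2).

Definition reduced (w : seq fletter) : bool :=
  sorted (fun l l' => l' != linv l) w.

Definition fcons (l : fletter) (w : seq fletter) : seq fletter :=
  if w is l' :: w' then (if l' == linv l then w' else l :: w) else [:: l].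

Record freeGroup := FreeGroup { fword :> seq fletter; _ : reduced fword }.

HB.instance Definition _ := [isSub for fword].
HB.instance Definition _ := [Choice of freeGroup by <:].

Lemma fwordP (u : freeGroup) : reduced u. Proof. by case: u. Qed.

Lemma linvK : involutive linv.
Proof. by case=> x b; rewrite /linv /= negbK. Qed.

Lemma reduced_behead l w : reduced (l :: w) -> reduced w.
Proof. by case: w => //= l' w /andP[]. Qed.

Lemma fcons_reduced l w : reduced w -> reduced (fcons l w).
Proof.
case: w => //= l' w rw; case: ifPn => [_|ll']; first exact: reduced_behead rw.
by rewrite /= ll'.
Qed.

Lemma foldr_fcons_reduced u w : reduced w -> reduced (foldr fcons w u).
Proof. by move=> rw; elim: u => //= l u; apply: fcons_reduced. Qed.

Lemma fconsE l w : reduced (l :: w) -> fcons l w = l :: w.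
Proof. by case: w => //= l' w /andP[/negPf ->]. Qed.

Lemma fconsK l w : reduced w -> fcons l (fcons (linv l) w) = w.
Proof.
case: w => [|l' w] rw; first by rewrite /= eqxx.
rewrite {2}/fcons linvK; have [ll'|ll'] := eqVneq l' l; last by rewrite /= eqxx.
by rewrite ll' in rw *; apply: fconsE.
Qed.

Lemma foldr_fconsA u v w : reduced w ->
  foldr fcons w (foldr fcons v u) = foldr fcons (foldr fcons w v) u.
Proof.
move=> rw; elim: u => //= l u <-.
case: (foldr fcons v u) => //= l' s; case: ifP => // /eqP ->.
by rewrite /= fconsK // foldr_fcons_reduced.
Qed.

Lemma foldr_fcons_nil u : reduced u -> foldr fcons [::] u = u.
Proof.
elim: u => //= l u IH ru; rewrite IH; last exact: reduced_behead ru.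
exact: fconsE.
Qed.

Definition finv (u : seq fletter) : seq fletter := rev (map linv u).

Lemma finv_reduced u : reduced u -> reduced (finv u).
Proof.
rewrite /reduced /finv rev_sorted sorted_map; apply: sub_sorted => l l'.
by rewrite /relpre /= linvK eq_sym.
Qed.

Lemma finvK u : finv (finv u) = u.
Proof. by rewrite /finv map_rev revK (mapK linvK). Qed.

Lemma foldr_fcons_inv u : foldr fcons u (finv u) = [::].
Proof.
elim: u => //= l u IH.
by rewrite /finv /= rev_cons foldr_rcons /= linvK eqxx.
Qed.

Definition fg_one : freeGroup := FreeGroup (isT : reduced [::]).
Definition fg_mul (u v : freeGroup) : freeGroup :=
  FreeGroup (foldr_fcons_reduced u (fwordP v)).
Definition fg_inv (u : freeGroup) : freeGroup :=
  FreeGroup (finv_reduced (fwordP u)).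

Lemma fg_mulA : associative fg_mul.
Proof. by move=> u v w; apply: val_inj; rewrite /= foldr_fconsA ?fwordP. Qed.

Lemma fg_mul1g : left_id fg_one fg_mul.
Proof. by move=> u; apply: val_inj. Qed.

Lemma fg_mulg1 : right_id fg_one fg_mul.
Proof. by move=> u; apply: val_inj; apply: foldr_fcons_nil; apply: fwordP. Qed.

Lemma fg_mulVg : left_inverse fg_one fg_inv fg_mul.
Proof. by move=> u; apply: val_inj; apply: foldr_fcons_inv. Qed.

Lemma fg_mulgV : right_inverse fg_one fg_inv fg_mul.
Proof.
by move=> u; apply: val_inj; rewrite /= -{2}(finvK u) foldr_fcons_inv.
Qed.

HB.instance Definition _ := isMonoid.Build freeGroup fg_mulA fg_mul1g fg_mulg1.
HB.instance Definition _ := hasInv.Build freeGroup fg_inv.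
HB.instance Definition _ := Monoid_isGroup.Build freeGroup fg_mulVg fg_mulgV.

Definition fg_gen (x : X) : freeGroup :=
  FreeGroup (isT : reduced [:: (x, true)]).

End FreeGroup.

Definition extends_system (E : finWeightedGraph) (D : dynSystem E)
    (th : partialAction (freeGroup (wsym E)) D) : Prop :=
  forall x : wsym E,
    [/\ pa_dom th (fg_gen x)^-1%g = ds_rng x,
        pa_dom th (fg_gen x) = ds_src x &
        forall y, ds_rng x y -> pa_act th (fg_gen x) y = ds_theta x y].

(* Main.v *)
Require Import Defs.
From HB Require Import structures.
From mathcomp Require Import all_boot all_algebra finmap.
From mathcomp Require Import all_classical topology.

(** Each symbol [x = e_i] gives two letters [x] and [x^-1] of the free group
[F]. In a dynamical system the letter [l] has a clopen set [H_l], and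
[theta_l] is a homeomorphism from [H_(l^-1)] onto [H_l]. Group the letters
into classes: for a vertex [v] and an index [i], the [e_i] with [s(e) = v];
for an edge [e], all the [e_i^-1]. Both kinds of partition in the definition
of a system then say the same thing: for each class at [v], the sets [H_l] of
its letters partition [Omega_v]. The relations of [L_1] take the same form: for
each class at [v], the range projections of its letters are orthogonal and
add up to [v]. Everything below treats the two kinds of letters alike.

A point [y] of a system has an itinerary, the set of the reduced words [g]
such that [y] lies in the range of [theta_g]. It contains the empty word, is
closed under prefixes, and every word [g] in it has a vertex [v] such that the
letters [l] with [g l] in the set are one letter from each class at [v].
Call any set of words with these properties a configuration. The universal
system is the space of configurations, on which [F] acts partially by left
translation. Each condition concerns finitely many words, so a limit of
configurations along an ultrafilter is a configuration, and the space is
compact. An equivariant map into it can only send a point to its itinerary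
([equivariant_itinerary]), and this map is continuous and equivariant.

For the isomorphism, let [u_g] be the element of [L^ab] given by the word [g]
and [p_g] its range projection. As the [p_g] commute, [u_g u_h = p_g u_(gh)]
([ugroup_mul]), and every element is a sum of terms [b_g u_g] with [b_g] in
the commutative algebra [B] generated by the projections ([graded_all]). The
crossed product contains the functions [1_(dom g) delta_g], which satisfy the
relations of [L^ab] ([config_family]); this gives a homomorphism [phi] with
[phi u_g = 1_(dom g) delta_g].

It is surjective because, by compactness, the functions [1_(dom g)] generate
all locally constant functions ([in_image_cont]). As [phi] respects the
grading by [F], it is injective if it is injective on [B]. Let [q] be a
nonzero element of [B]. For each finite set [S] of words there is [r] in [B]
with [r q <> 0] such that [p_g r] is [r] or [0] for every [g] in [S]. A limit
along an ultrafilter yields one set of words [xi] that prescribes these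
eigenvalues for all [S] at once, and the relations of [L^ab] force [xi] to be
a configuration ([eigen_config]). For [S] large enough, [q] multiplies [r] by
the value of [phi q] at [xi], which is therefore nonzero. *)

Set Implicit Arguments.
Unset Strict Implicit.
Unset Printing Implicit Defensive.

Import GRing.Theory.

Local Open Scope classical_set_scope.

(** * Letters, their classes, and configurations *)

Section Letters.
Variable E : finWeightedGraph.

Definition letter : Type := fletter (wsym E).
Definition lvert (l : letter) : gvert E :=
  if l.2 then gsrc (wedge l.1) else grng (wedge l.1).

(** A class indexes one of the partitions of a system: [inl (v, i)] that of
[Omega_v] into the ranges of the [e_i] with [i] fixed, [inr e] that of
[Omega_(r e)] into the domains of the [e_i] with [e] fixed. *)
Definition lclass (l : letter) : (gvert E * nat) + gedge E :=
  if l.2 then inl (gsrc (wedge l.1), windex l.1) else inr (wedge l.1).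

Definition class_at (v : gvert E) (c : (gvert E * nat) + gedge E) : bool :=
  match c with
  | inl (w, i) => (w == v) && (i < vweight v)
  | inr e => grng e == v
  end.

Lemma windex_lt (x : wsym E) : windex x < vweight (gsrc (wedge x)).
Proof.
apply: leq_trans (ltn_ord (tagged x)) _.
by rewrite /vweight (bigmax_sup (wedge x)).
Qed.

Lemma class_at_lclass l : class_at (lvert l) (lclass l).
Proof. by case: l => x [] /=; rewrite eqxx // windex_lt. Qed.

Lemma class_at_vert v l : class_at v (lclass l) -> lvert l = v.
Proof. by case: l => x [] /= => [/andP[/eqP]|/eqP]. Qed.

(** The hypothesis that no vertex is isolated enters here. It lets the letters
defined at a point determine the vertex of the point, and it lets the vertices
of the algebra be written with range projections. *)
Lemma class_at_exists v : exists c, class_at v c.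
Proof.
case: (gno_isolated v) => [[e ev]|[e ev]].
  exists (inl (v, 0)) => /=; rewrite eqxx /= -ev.
  exact: leq_trans (windex_lt (wsymb (Ordinal (gweight_gt0 e)))).
by exists (inr e) => /=; rewrite ev.
Qed.

(** [N] is meant as the set of the letters [l] such that a given point of
[Omega_v] lies in [H_l]. *)
Definition local_rule (N : letter -> bool) (v : gvert E) : Prop :=
  [/\ forall l, N l -> lvert l = v,
      forall c, class_at v c -> exists2 l, lclass l = c & N l &
      forall l m, N l -> N m -> lclass l = lclass m -> l = m].

Lemma local_rule_vert N v w : local_rule N v -> local_rule N w -> v = w.
Proof.
move=> [Nv ex _] [Nw _ _]; have [c /ex[l _ Nl]] := class_at_exists v.
by rewrite -(Nv l Nl) (Nw l Nl).
Qed.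

Definition fg_letter (l : letter) : freeGroup (wsym E) :=
  FreeGroup (isT : reduced [:: l]).

Lemma fg_letter_gen x : fg_gen x = fg_letter (x, true).
Proof. exact: val_inj. Qed.

Lemma fg_letterV l : (fg_letter l)^-1%g = fg_letter (linv l).
Proof. exact: val_inj. Qed.

Lemma fword1 : fword (1%g : freeGroup (wsym E)) = [::].
Proof. by []. Qed.

Lemma fg_letter_mul l (g : freeGroup (wsym E)) :
  reduced (l :: fword g) -> fword (fg_letter l * g)%g = l :: fword g.
Proof. exact: fconsE. Qed.

Lemma fg_ind (P : freeGroup (wsym E) -> Prop) :
    P 1%g ->
    (forall l g, reduced (l :: fword g) -> P g -> P (fg_letter l * g)%g) ->
  forall g, P g.
Proof.
move=> P1 Pl [w rw]; elim: w rw => [|l w IH] rw.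
  by congr P: P1; apply: val_inj.
have rw' := reduced_behead rw; have := Pl l (FreeGroup rw') rw (IH rw').
by congr P; apply: val_inj; apply: fconsE.
Qed.

Lemma fg_letterK l (g : freeGroup (wsym E)) :
  (fg_letter (linv l) * (fg_letter l * g) = g)%g.
Proof. by rewrite -fg_letterV mulKg. Qed.

Lemma fg_letterVK l (g : freeGroup (wsym E)) :
  (fg_letter l * (fg_letter (linv l) * g) = g)%g.
Proof. by rewrite -fg_letterV mulVKg. Qed.

(** Left multiplication by a letter that does not lengthen a word cancels the
first letter. *)
Lemma fg_letter_reducedP l (g : freeGroup (wsym E)) :
  ~~ reduced (l :: fword g) ->
  exists2 h, g = (fg_letter (linv l) * h)%g & reduced (linv l :: fword h).
Proof.
case: g => -[|m w] rw //=; have rw2 := rw; rewrite /reduced /= in rw2.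
rewrite rw2 andbT negbK => /eqP ml.
move: rw; rewrite ml => rw; have rw' := reduced_behead rw.
by exists (FreeGroup rw') => //; apply: val_inj;
  rewrite /= -/(fcons _ _) fconsE.
Qed.

(** A configuration is a subtree of the Cayley tree of the free group, rooted
at [1], that has at each node the edges prescribed by a vertex. *)
Definition is_config (xi : freeGroup (wsym E) -> bool) : Prop :=
  [/\ xi 1%g,
      forall g h : freeGroup (wsym E),
        prefix (fword g) (fword h) -> xi h -> xi g &
      forall g, xi g ->
        exists v, local_rule (fun l => xi (g * fg_letter l)%g) v].

(** Each condition looks at finitely many words: for the local rule at [g], at
[g] and its neighbours [g l]. *)
Lemma config_closed (xi : freeGroup (wsym E) -> bool) :
    (forall S : seq (freeGroup (wsym E)), exists2 zeta, is_config zeta &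
      forall g, g \in S -> zeta g = xi g) ->
  is_config xi.
Proof.
move=> xiS; split.
- have [zeta [z1 _ _] zE] := xiS [:: 1%g].
  by rewrite -zE ?mem_head.
- move=> g h gh; have [zeta [_ zp _] zE] := xiS [:: g; h].
  by rewrite -!zE ?inE ?eqxx ?orbT //; apply: zp.
- move=> g xg.
  have [zeta [_ _ zr] zE] :=
    xiS (g :: [seq (g * fg_letter l)%g | l <- enum {: wsym E * bool}]).
  have zgE l : zeta (g * fg_letter l)%g = xi (g * fg_letter l)%g.
    by apply: zE; rewrite inE; apply/orP; right; apply: map_f; rewrite mem_enum.
  have [|v [rv rc ru]] := zr g; first by rewrite zE ?mem_head.
  exists v; split=> [l|c cv|l m]; rewrite -?zgE; [exact: rv| |exact: ru].
  by have [l lc zl] := rc c cv; exists l; rewrite -?zgE.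
Qed.

(** The translate is again a subtree, and it contains [1] by the hypothesis on
[l]. Only closure under prefixes needs care, since the translation cancels or
prepends the first letter of a word. *)
Lemma config_shift l xi : is_config xi -> xi (fg_letter (linv l)) ->
  is_config (fun g => xi (fg_letter (linv l) * g)%g).
Proof.
move=> [x1 xp xr] xl; split; first by rewrite mulg1.
- move=> g h gh xh.
  have [rh|] := boolP (reduced (linv l :: fword h)).
    apply: xp xh; rewrite (fg_letter_mul rh).
    have gh' : prefix (linv l :: fword g) (linv l :: fword h).
      by rewrite /= eqxx.
    (* [linv l :: g] is reduced too, being a prefix of a reduced word *)
    rewrite fg_letter_mul //; move: rh.
    rewrite /reduced => /(take_sorted (size (fword g)).+1).
    by move: gh'; rewrite prefixE => /eqP <-.
  move=> /fg_letter_reducedP[h' hE rh'].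
  move: hE rh' gh xh; rewrite linvK => -> rh'.
  rewrite fg_letterK fg_letter_mul //.
  case gE : (fword g) => [|m w].
    by move=> _ _; have -> : g = 1%g by [apply: val_inj]; rewrite mulg1.
  move=> /= /andP[/eqP ml wh]; apply: xp.
  have [rw|/fg_letter_reducedP[k kE rk]] := boolP (reduced (linv l :: fword g)).
    by move: rw; rewrite gE ml /= linvK eqxx.
  rewrite linvK in kE rk; rewrite kE fg_letterK.
  by move: gE; rewrite kE fg_letter_mul // => -[_ ->].
- move=> g /xr[v rv]; exists v.
  by under [X in local_rule X]eq_fun do rewrite mulgA.
Qed.

End Letters.

(** * The space of configurations *)

Section UltraLimit.

Definition ulim (I X : Type) (U : set_system I) (f : I -> X -> bool) :
  X -> bool := fun x => `[< U [set i | f i x] >].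

(** On finitely many points the limit agrees with almost all members. *)
Lemma ulim_near (I : Type) (X : choiceType) (U : set_system I)
    (f : I -> X -> bool) (S : seq X) :
  UltraFilter U -> U [set i | forall x, x \in S -> f i x = ulim U f x].
Proof.
move=> UU; elim: S => [|x S IH]; first by apply: filterS filterT.
have Ux : U [set i | f i x = ulim U f x].
  rewrite /ulim; have [fx|nfx] := pselect (U [set i | f i x]).
    by rewrite asboolT //; apply: filterS fx.
  rewrite asboolF //; have [//|] := in_ultra_setVsetC [set i | f i x] UU.
  by apply: filterS => i /= /negP/negPf.
by apply: filterS2 Ux IH => i fx fS y; rewrite inE => /predU1P[->|/fS].
Qed.

End UltraLimit.

Section ConfigSpace.
Variable E : finWeightedGraph.
Local Notation F := (freeGroup (wsym E)).

Record config := Config { cfg :> F -> bool; configP : is_config cfg }.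

Lemma config_eq (x y : config) : (forall g, x g = y g) -> x = y.
Proof.
case: x y => [x xP] [y yP] /= xy; have {}xy : x = y by apply/funext.
by subst y; congr Config; apply: Prop_irrelevance.
Qed.

HB.instance Definition _ := gen_eqMixin config.
HB.instance Definition _ := gen_choiceMixin config.

Definition agree (S : seq F) (x y : config) : Prop :=
  forall g, g \in S -> y g = x g.

(** This is the topology of pointwise convergence, given by its basic
neighbourhoods so that membership unfolds to agreement on a finite set. *)
Definition config_nbhs (x : config) : set_system config :=
  [set A | exists S, agree S x `<=` A].

HB.instance Definition _ := hasNbhs.Build config config_nbhs.

Lemma config_nbhs_filter (x : config) : ProperFilter (nbhs x).
Proof.
split; first by move=> [S /(_ x)]; apply.
split.
- by exists [::].
- move=> A B [S SA] [S' SB]; exists (S ++ S') => y yS.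
  by split; [apply: SA|apply: SB] => g gS; apply: yS; rewrite mem_cat gS ?orbT.
- by move=> A B AB [S SA]; exists S; apply: subset_trans AB.
Qed.

Lemma config_nbhs_singleton (x : config) (A : set config) : nbhs x A -> A x.
Proof. by move=> [S]; apply. Qed.

Lemma config_nbhs_nbhs (x : config) (A : set config) :
  nbhs x A -> nbhs x (nbhs^~ A).
Proof.
move=> [S SA]; exists S => y yS; exists S => z zS.
by apply: SA => g gS; rewrite zS // yS.
Qed.

HB.instance Definition _ := Nbhs_isNbhsTopological.Build config
  config_nbhs_filter config_nbhs_singleton config_nbhs_nbhs.

Lemma nbhs_agree S (x : config) : nbhs x (agree S x).
Proof. by exists S. Qed.

Lemma nbhs_config_at g (x : config) : \forall y \near x, (y : config) g = x g.
Proof. by exists [:: g] => y; apply; rewrite mem_head. Qed.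

Lemma agree_clopen S (A : set config) :
  (forall x y, agree S x y -> A x -> A y) -> clopen A.
Proof.
move=> SA; split; last rewrite -openC; rewrite openE => x Ax; exists S => y xy.
  exact: SA Ax.
by apply: contra_not Ax; apply: SA => g gS; rewrite xy.
Qed.

Lemma config_hausdorff : hausdorff_space config.
Proof.
move=> x y xy; apply: config_eq => g.
by have [z [<- <-]] := xy _ _ (nbhs_config_at g x) (nbhs_config_at g y).
Qed.

(** The limit of an ultrafilter agrees on each finite set with a configuration,
hence is one. *)
Lemma config_compact : compact [set: config].
Proof.
move=> H HF _; have [U [UU HU]] := ultraFilterLemma HF.
pose ev (x : config) : F -> bool := x.
pose xi := ulim U ev.
have xiP : is_config xi.
  apply: config_closed => S.
  have [x xS] := filter_ex (ulim_near ev S UU).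
  by exists x => //; apply: configP.
exists (Config xiP); split=> // A B HA [S SB].
have [x [Ax xS]] := filter_ex (filterI (HU _ HA) (ulim_near ev S UU)).
by exists x; split=> //; apply: SB.
Qed.

Definition shift (g : F) (x : F -> bool) : F -> bool := fun h => x (g^-1 * h)%g.

(** Translate by one letter of [g] at a time: the inverses of the words read so
far are prefixes of [g^-1], so they lie in [x] and each translation is
defined. *)
Lemma shift_config g (x : F -> bool) :
  is_config x -> x g^-1%g -> is_config (shift g x).
Proof.
elim/fg_ind: g => [|l g rlg IH] xc.
  move=> _; rewrite (_ : shift _ _ = x) //; apply/funext => h.
  by rewrite /shift invg1 mul1g.
rewrite invgM fg_letterV => xlg.
have xg : x g^-1%g.
  case: xc => _ xp _; apply: xp xlg.
  rewrite (_ : fword (g^-1 * fg_letter (linv l))%g =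
    rcons (fword g^-1%g) (linv l)).
    by rewrite -cats1 prefix_prefix.
  have : fword (fg_letter l * g)^-1%g = rcons (fword g^-1%g) (linv l).
    by rewrite -[LHS]/(Defs.finv (fword (fg_letter l * g)%g)) fg_letter_mul //
      /Defs.finv /= rev_cons.
  by rewrite invgM fg_letterV.
have -> : shift (fg_letter l * g)%g x = fun h =>
  shift g x (fg_letter (linv l) * h)%g.
  by apply/funext => h; rewrite /shift invgM mulgA fg_letterV.
by apply: config_shift; [exact: IH|].
Qed.

(** Partial actions are given by total maps, hence the identity outside of the
domain. *)
Definition cshift (g : F) (x : config) : config :=
  match pselect (x g^-1%g) with
  | left xg => Config (shift_config (configP x) xg)
  | right _ => x
  end.

Lemma cshiftE g (x : config) h : x g^-1%g -> cshift g x h = x (g^-1 * h)%g.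
Proof. by move=> xg; rewrite /cshift; case: pselect. Qed.

Definition cdom (g : F) : set config := [set x : config | x g].

Lemma cdom_clopen g : clopen (cdom g).
Proof.
by apply: (@agree_clopen [:: g]) => x y xy; rewrite /cdom /= xy ?mem_head.
Qed.

Lemma cshift_dom g x : cdom g^-1%g x -> cdom g (cshift g x).
Proof. by move=> xg; rewrite /cdom /= cshiftE // mulVg; case: (configP x). Qed.

Lemma cshift_cont g : {within cdom g^-1%g, continuous (cshift g)}.
Proof.
rewrite continuous_open_subspace; last by case: (cdom_clopen g^-1%g).
move=> x /set_mem xg A [S SA].
exists (g^-1%g :: [seq (g^-1 * h)%g | h <- S]) => y yx /=.
have yg : y g^-1%g by rewrite yx ?mem_head.
apply: SA => h hS; rewrite !cshiftE // yx // inE; apply/orP; right.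
by apply: map_f.
Qed.

Lemma cshift_homeo g : homeo_on (cdom g^-1%g) (cdom g) (cshift g).
Proof.
exists (cshift g^-1%g); split; last first.
  by split; [|have := @cshift_cont g^-1%g; rewrite invgK];
    first exact: cshift_cont.
split.
- exact: cshift_dom.
- by move=> y yg; apply: cshift_dom; rewrite invgK.
- move=> x xg; apply: config_eq => h.
  have gx : cshift g x g := cshift_dom xg.
  by rewrite cshiftE ?invgK // cshiftE // mulKg.
- move=> y yg; apply: config_eq => h.
  have gx : cshift g^-1%g y g^-1%g by apply: cshift_dom; rewrite invgK.
  by rewrite cshiftE // cshiftE ?invgK // mulVKg.
Qed.

Definition config_action : partialAction F config.
Proof.
apply: (@PartialAction _ _ cdom cshift cdom_clopen cshift_homeo).
- by apply/seteqP; split=> x // _; case: (configP x).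
- move=> x; apply: config_eq => h; rewrite cshiftE ?invg1 ?mul1g //.
  by case: (configP x).
- move=> g h x xh; rewrite /cdom /= cshiftE // -invgM => xgh; split=> //.
  apply: config_eq => k; rewrite !cshiftE // -?invgM //.
  by rewrite invgM mulgA.
Defined.

Definition cvert (v : gvert E) : set config :=
  [set x : config | local_rule (fun l => x (fg_letter l)) v].

(** The local rule at the word [1]. *)
Lemma cvert_exists (x : config) : exists v, cvert v x.
Proof.
case: (configP x) => x1 _ /(_ _ x1)[v rv]; exists v.
rewrite /cvert /=.
by under [X in local_rule X]eq_fun do rewrite -(mul1g (fg_letter _)).
Qed.

Lemma cvert_inj v w x : cvert v x -> cvert w x -> v = w.
Proof. exact: local_rule_vert. Qed.

Lemma cvert_letter (x : config) l : x (fg_letter l) -> cvert (lvert l) x.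
Proof.
by move=> xl; have [v xv] := cvert_exists x; case: (xv) => /(_ l xl) ->.
Qed.

Lemma cvert_clopen v : clopen (cvert v).
Proof.
apply: (@agree_clopen [seq fg_letter l | l <- enum {: wsym E * bool}]) =>
  x y xy.
have yE l : y (fg_letter l) = x (fg_letter l).
  by apply/xy/map_f; rewrite mem_enum.
by rewrite /cvert /=; under [X in _ -> local_rule X v]eq_fun do rewrite yE.
Qed.

Lemma cvert_part : disjoint_union [set: config] [set: gvert E] cvert.
Proof.
split; first by move=> v w _ _ [x [xv xw]]; apply: cvert_inj xw.
by apply/seteqP; split=> x // _; have [v xv] := cvert_exists x; exists v.
Qed.

End ConfigSpace.

(** * The dynamical system of configurations *)

Section ConfigSystem.
Variable E : finWeightedGraph.
Local Notation F := (freeGroup (wsym E)).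
Local Notation config := (config E).

(** The common form of the two families of partitions. *)
Lemma cdom_class (v : gvert E) c : class_at v c ->
  disjoint_union (cvert v) [set l | lclass l = c] (fun l => cdom (fg_letter l)).
Proof.
move=> cv; split.
  move=> l m lc mc [x [xl xm]]; have [w [_ _ ru]] := cvert_exists x.
  by apply: ru; rewrite ?lc.
apply/seteqP; split=> x.
  by case=> _ /(_ c cv)[l lc xl] _; exists l.
by case=> l /= lc xl; have := cvert_letter xl; rewrite (@class_at_vert _ v) ?lc.
Qed.

(** Passes from a class of letters to the symbols that name them. *)
Lemma disjoint_union_reindex (T I J : Type) (A : set T) (D : set I) (D' : set J)
    (h : J -> I) (G : I -> set T) :
    injective h -> D = h @` D' -> disjoint_union A D G ->
  disjoint_union A D' (G \o h).
Proof.
move=> hI -> [tG ->]; split.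
  by move=> i j Di Dj /(tG _ _ (imageP h Di) (imageP h Dj))/hI.
apply/seteqP; split=> x; first by case=> _ [j Dj <-] Gx; exists j.
by case=> j Dj Gx; exists (h j).
Qed.

Definition config_system : dynSystem E.
Proof.
apply: (@DynSystem E config (@config_compact E) (@config_hausdorff E)
  (@cvert E) (fun x => cdom (fg_gen x)) (fun x => cdom (fg_gen x)^-1%g)
  (fun x => cshift (fg_gen x))).
- exact: cvert_clopen.
- by move=> x; apply: cdom_clopen.
- by move=> x; apply: cdom_clopen.
- exact: cvert_part.
- move=> v i iv.
  have cv : class_at v (inl (v, i)) by rewrite /= eqxx.
  have := disjoint_union_reindex
    (h := fun x : wsym E => (x, true)) _ _ (cdom_class cv).
  apply; first by move=> x y [].
  apply/seteqP; split=> [[x []]//= [<- <-]|_ [x [<- <-] <-] //].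
  by exists x.
- move=> e.
  have cv : class_at (grng e) (inr e) by rewrite /= eqxx.
  under [X in disjoint_union _ _ X]eq_fun do rewrite fg_letter_gen fg_letterV.
  have := disjoint_union_reindex (D' := [set: 'I_(gweight e)])
    (h := fun i => (wsymb i, false)) _ _ (cdom_class cv).
  apply; first by move=> i j [] /eqP; rewrite eq_Tagged => /eqP.
  apply/seteqP; split=> [[[f i] []]//= [fe]|_ [i _ <-] //].
  by move: i; rewrite -fe => i; exists i.
- by move=> x; apply: cshift_homeo.
Defined.

Lemma config_extends : @extends_system E config_system (config_action E).
Proof. by []. Qed.

End ConfigSystem.

(** * Itineraries and universality *)

Section Universality.
Variable E : finWeightedGraph.
Local Notation F := (freeGroup (wsym E)).
Variable D : dynSystem E.

Definition ldom (l : letter E) : set D :=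
  if l.2 then ds_src l.1 else ds_rng l.1.

(** For an inverse letter, a chosen inverse of the homeomorphism. *)
Definition lact (l : letter E) : D -> D :=
  if l.2 then ds_theta l.1 else projT1 (cid (ds_theta_homeo D l.1)).

Lemma ldom_clopen l : clopen (ldom l).
Proof. by case: l => x []; [apply: ds_src_clopen|apply: ds_rng_clopen]. Qed.

Lemma lact_dom l y : ldom (linv l) y -> ldom l (lact l y).
Proof.
case: l => x []; rewrite /ldom /lact /=; last by case: cid => g [[]]/=; auto.
by move=> xy; have [g [[th _ _ _] _]] := ds_theta_homeo D x; apply: th.
Qed.

Lemma lactK l y : ldom (linv l) y -> lact (linv l) (lact l y) = y.
Proof.
by case: l => x []; rewrite /ldom /lact /=; case: cid => g [[]]/=; auto.
Qed.

Lemma lact_cont l : {within ldom (linv l), continuous (lact l)}.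
Proof.
case: l => x []; rewrite /ldom /lact /=; last by case: cid => g /= [_ []].
by have [g [_ []]] := ds_theta_homeo D x.
Qed.

(** A point lies in the range of [theta_l theta_w] when it lies in the range of
[theta_l] and its preimage lies in that of [theta_w]. *)
Fixpoint wdom (w : seq (letter E)) (y : D) : bool :=
  if w is l :: w' then `[< ldom l y >] && wdom w' (lact (linv l) y) else true.

Lemma wdom_near w y : \forall z \near y, wdom w z = wdom w y.
Proof.
elim: w y => [|l w IH] y /=; first exact: nearW.
have [ol cl] := ldom_clopen l.
have [yl|yl] := pselect (ldom l y); last first.
  have : \forall z \near y, (~` ldom l) z.
    by apply: open_nbhs_nbhs; split=> //; apply: closed_openC.
  by apply: filterS => z /= zl; rewrite !asboolF.
have nl : \forall z \near y, ldom l z by apply: open_nbhs_nbhs.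
have : {within ldom l, continuous (lact (linv l))}.
  by have := @lact_cont (linv l); rewrite linvK.
rewrite continuous_open_subspace // => /(_ y (mem_set yl)) /(_ _ (IH _)) nw.
have {}nw : \forall z \near y,
    wdom w (lact (linv l) z) = wdom w (lact (linv l) y) := nw.
by apply: filterS2 nl nw => z zl /= ->; rewrite !asboolT.
Qed.

Lemma wdom_prefix u w y : prefix u w -> wdom w y -> wdom u y.
Proof.
elim: u w y => // l u IH [|m w] y //= /andP[/eqP <- uw] /andP[-> /=].
exact: IH.
Qed.

Definition itinerary (y : D) (g : F) : bool := wdom (fword g) y.

(** Also true when [l] cancels the first letter of [g]: the letter read after
[l] then leads back to [y]. *)
Lemma itinerary_letterM l y g : ldom l y ->
  itinerary y (fg_letter l * g)%g = itinerary (lact (linv l) y) g.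
Proof.
move=> yl; rewrite /itinerary.
have [rg|/fg_letter_reducedP[h -> rh]] := boolP (reduced (l :: fword g)).
  by rewrite fg_letter_mul //= asboolT.
have yl' : ldom (linv l) (lact (linv l) y) by apply: lact_dom; rewrite linvK.
by rewrite fg_letterVK fg_letter_mul //= asboolT //= lactK // linvK.
Qed.

(** The axioms of a system say that the letters defined at a point obey the
local rule. *)
Lemma ldom_local_rule (y : D) :
  exists2 v, ds_vert v y & local_rule (fun l => `[< ldom l y >]) v.
Proof.
have [_ /seteqP[/(_ y I)[v _ yv] _]] := ds_vert_part D; exists v => //.
have [tV _] := ds_vert_part D.
have lv l : ldom l y -> lvert l = v.
  move=> yl; apply: (tV _ _ I I); exists y; split=> //.
  case: l yl => x [] /= yl; rewrite /lvert /=.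
    have [_ ->] := ds_src_part D (windex_lt x); by exists x.
  have [_ ->] := ds_rng_part D (wedge x); exists (tagged x) => //.
  by case: (x) yl.
split=> [l /asboolP/lv //|[[w i]|e]|l m /asboolP yl /asboolP ym].
- move=> /andP[/eqP -> iv]; have [_ vE] := ds_src_part D iv.
  move: yv; rewrite vE => -[x [xv xi] yx]; exists (x, true).
    by rewrite /lclass /= xv xi.
  exact/asboolP.
- move=> /eqP ev; have [_ vE] := ds_rng_part D e.
  move: yv; rewrite -ev vE => -[i _ yi]; exists (wsymb i, false) => //.
  exact/asboolP.
- case: l m yl ym => x [] [z []] //=; rewrite /ldom /lclass /= => yx yz.
    move=> -[xz xz']; congr (_, _); have [tS _] := ds_src_part D (windex_lt x).
    by apply: tS => //; exists y.
  case: x z yx yz => e i [f j] yx yz /= [ef]; move: j yz; rewrite -ef => j yz.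
  congr (Tagged _ _, _); have [tR _] := ds_rng_part D e.
  by apply: tR => //; exists y.
Qed.

(** The local rule at a word [g] of the itinerary is the one at the point
reached after reading [g]. *)
Lemma itinerary_config y : is_config (itinerary y).
Proof.
split=> // [g h|g]; first exact: wdom_prefix.
elim/fg_ind: g y => [|l g rg IH] y.
  move=> _; have [v _ rv] := ldom_local_rule y; exists v.
  under [X in local_rule X]eq_fun do rewrite mul1g.
  by rewrite /itinerary /=; under [X in local_rule X]eq_fun do rewrite andbT.
have [yl|yl] := pselect (ldom l y); last first.
  by rewrite /itinerary fg_letter_mul //= asboolF.
rewrite itinerary_letterM // => /IH[v rv]; exists v.
by under [X in local_rule X]eq_fun do rewrite -mulgA itinerary_letterM //.
Qed.

Definition itinerary_map (y : D) : config E := Config (itinerary_config y).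

Lemma itinerary_continuous : continuous (itinerary_map : D -> config E).
Proof.
move=> y A [S SA].
suff : \forall z \near y, agree S (itinerary_map y) (itinerary_map z).
  by apply: filterS => z; apply: SA.
elim: S {A SA} => [|g S IH]; first exact: nearW.
apply: filterS2 (wdom_near (fword g) y) IH => z zg zS h.
by rewrite inE => /predU1P[->|/zS].
Qed.

Lemma itinerary_vert v y : ds_vert v y -> cvert v (itinerary_map y).
Proof.
move=> yv; have [w yw rw] := ldom_local_rule y.
have -> : v = w by have [tV _] := ds_vert_part D; apply: tV => //; exists y.
by rewrite /cvert /= /itinerary /=;
  under [X in local_rule X]eq_fun do rewrite andbT.
Qed.

Lemma itinerary_letter l y : ldom l y -> itinerary y (fg_letter l).
Proof. by move=> yl; rewrite /itinerary /= asboolT. Qed.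

Lemma itinerary_equivariant : @equivariant E D (config_system E) itinerary_map.
Proof.
split.
- exact: itinerary_vert.
- by move=> x y yx; apply: (@itinerary_letter (x, true)).
- by move=> x y yx; rewrite /= /cdom /= fg_letter_gen fg_letterV;
    apply: (@itinerary_letter (x, false)).
- move=> x y yx; apply: config_eq => g /=.
  have yl : itinerary y (fg_gen x)^-1%g.
    by rewrite fg_letter_gen fg_letterV; apply: (@itinerary_letter (x, false)).
  by rewrite cshiftE //= fg_letter_gen fg_letterV itinerary_letterM.
Qed.

(** Read a word letter by letter. If its first letter [l] is defined at [y],
equivariance moves the question to the next point. If it is not, then another
letter of the class of [l] is defined at [y], hence in [f y], which excludes
[l] from [f y]. *)
Lemma equivariant_itinerary (f : D -> config E) :
  @equivariant E D (config_system E) f -> f = itinerary_map.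
Proof.
move=> [fv fs fr ft].
have fdom l y : ldom l y -> f y (fg_letter l).
  case: l => x [] /= yl; first exact: fs.
  by have := fr _ _ yl; rewrite /= /cdom /= fg_letter_gen fg_letterV.
(* Equivariance speaks of [theta_x]; reading the letter [x] moves a point along
   its inverse, so there it is applied at the preimage of [y]. *)
have fact l y g : ldom l y -> f y (fg_letter l * g)%g = f (lact (linv l) y) g.
  case: l => x [] yl.
    set z := lact _ _; have zx : ds_rng x z by apply: (@lact_dom (x, false)).
    have -> : y = ds_theta x z := esym (@lactK (x, false) y yl).
    by rewrite -ft //= cshiftE ?fg_letter_gen ?fg_letterV ?fg_letterK //;
      apply: (@fdom (x, false)).
  by rewrite -ft //= cshiftE ?fg_letter_gen ?fg_letterV ?linvK //;
    apply: (@fdom (x, false)).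
apply/funext => y; apply: config_eq => g; rewrite /= /itinerary.
elim/fg_ind: g y => [|l g rg IH] y.
  by rewrite fword1 /=; case: (configP (f y)).
rewrite fg_letter_mul //=; have [yl|yl] := pselect (ldom l y).
  by rewrite asboolT //= -IH fact.
rewrite asboolF //; apply/negbTE/negP => fyg; apply: yl.
have fyl : f y (fg_letter l).
  case: (configP (f y)) => _ fp _; apply: fp fyg.
  by rewrite fg_letter_mul //= eqxx prefix0s.
have [v yv [_ rc _]] := ldom_local_rule y.
have [fyv _ fyu] := fv _ _ yv.
have := class_at_lclass l; rewrite (fyv _ fyl) => /rc[m ml /asboolP ym].
by rewrite -(fyu m l) //; apply: fdom.
Qed.

End Universality.

Lemma config_universal (E : finWeightedGraph) :
  universal_system (config_system E).
Proof.
move=> D; exists (@itinerary_map E D); split.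
  by split; [apply: itinerary_continuous|apply: itinerary_equivariant].
by move=> f [_ /equivariant_itinerary].
Qed.

Local Open Scope ring_scope.

(** * Finite sums *)

Section ClassSums.
Variables (E : finWeightedGraph) (V : zmodType) (G : wsym E * bool -> V).

(** Sums over all letters are indexed by pairs, which carry the finite type
structure. *)
Lemma sum_letters (P : pred (wsym E * bool)) :
  \sum_(l | P l) G l =
  \sum_(x | P (x, true)) G (x, true) + \sum_(x | P (x, false)) G (x, false).
Proof.
rewrite (bigID (fun l => l.2)) /=; congr (_ + _).
- rewrite (reindex_onto (fun x => (x, true)) fst) /=.
    by apply: eq_bigl => x; rewrite eqxx !andbT.
  by case=> x [] //=; rewrite andbF.
- rewrite (reindex_onto (fun x => (x, false)) fst) /=.
    by apply: eq_bigl => x; rewrite eqxx !andbT.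
  by case=> x [] //=; rewrite andbF.
Qed.

Lemma sum_class_src v i :
  \sum_(l : wsym E * bool | lclass l == inl (v, i)) G l =
  \sum_(x : wsym E | (gsrc (wedge x) == v) && (windex x == i)) G (x, true).
Proof. by rewrite sum_letters [X in _ + X]big1 ?addr0. Qed.

Lemma sum_class_rng e :
  \sum_(l : wsym E * bool | lclass l == inr e) G l =
  \sum_(i < gweight e) G (wsymb i, false).
Proof.
rewrite sum_letters [X in X + _]big1 ?add0r //.
rewrite (reindex_onto (fun i : 'I_(gweight e) => wsymb i)
  (fun x => insubd (Ordinal (gweight_gt0 e)) (windex x))) /=.
  apply: eq_bigl => i; rewrite /lclass /= eqxx /=; apply/eqP/val_inj.
  by rewrite val_insubd ltn_ord.
case=> e' i; rewrite /lclass /= => /eqP[] /= ee; subst e'.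
by congr Tagged; apply: val_inj; rewrite val_insubd ltn_ord.
Qed.

End ClassSums.

Lemma sum_by_key (V : zmodType) (I J : eqType) (s : seq I) (key : I -> J)
    (H : I -> V) :
  \sum_(x <- s) H x =
  \sum_(j <- undup (map key s)) \sum_(x <- s | key x == j) H x.
Proof.
rewrite (exchange_big_dep predT) //=; apply: eq_big_seq => x xs.
rewrite big_mkcond (bigD1_seq (key x)) ?undup_uniq ?mem_undup ?map_f //= eqxx.
by rewrite big1 ?addr0 // => j; rewrite eq_sym => /negPf ->.
Qed.

(** * Algebras presented by generators and relations *)

Section StarAlgebraTheory.
Variables (K : fieldType) (conj : fieldInvolution K) (A : starAlgebra conj).
Implicit Types x y z : A.

Lemma sa_mul0l x : sa_mul (0 : A) x = 0.
Proof. by have := sa_mulZl 0 (0 : A) x; rewrite !scale0r. Qed.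

Lemma sa_mul0r x : sa_mul x (0 : A) = 0.
Proof. by have := sa_mulZr 0 x (0 : A); rewrite !scale0r. Qed.

Lemma sa_mulNl x y : sa_mul (- x) y = - sa_mul x y.
Proof. by rewrite -scaleN1r sa_mulZl scaleN1r. Qed.

Lemma sa_mulNr x y : sa_mul x (- y) = - sa_mul x y.
Proof. by rewrite -scaleN1r sa_mulZr scaleN1r. Qed.

Lemma sa_mulBl x y z : sa_mul (x - y) z = sa_mul x z - sa_mul y z.
Proof. by rewrite sa_mulDl sa_mulNl. Qed.

Lemma sa_mulBr x y z : sa_mul x (y - z) = sa_mul x y - sa_mul x z.
Proof. by rewrite sa_mulDr sa_mulNr. Qed.

Lemma sa_star0 : sa_star (0 : A) = 0.
Proof. by have := sa_starZ 0 (0 : A); rewrite rmorph0 !scale0r. Qed.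

Lemma sa_mul_suml (I : Type) (r : seq I) (P : pred I) (G : I -> A) y :
  sa_mul (\sum_(i <- r | P i) G i) y = \sum_(i <- r | P i) sa_mul (G i) y.
Proof.
pose mul_y z := sa_mul z y.
exact: (big_morph mul_y (fun a b => sa_mulDl a b y) (sa_mul0l y)).
Qed.

Lemma sa_mul_sumr (I : Type) (r : seq I) (P : pred I) (G : I -> A) y :
  sa_mul y (\sum_(i <- r | P i) G i) = \sum_(i <- r | P i) sa_mul y (G i).
Proof. exact: (big_morph (sa_mul y) (sa_mulDr y) (sa_mul0r y)). Qed.

Lemma sa_star_sum (I : Type) (r : seq I) (P : pred I) (G : I -> A) :
  sa_star (\sum_(i <- r | P i) G i) = \sum_(i <- r | P i) sa_star (G i).
Proof. exact: (big_morph (@sa_star _ _ A) (@sa_starD _ _ A) sa_star0). Qed.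

End StarAlgebraTheory.

Section ClassMorphism.
Variables (K : fieldType) (conj : fieldInvolution K) (T : choiceType).
Variable S : preStarAlgebra conj T.
Local Notation cl := (ps_class S : T -> star_quotient S).

Lemma ps_classD x y : cl (ps_add S x y) = cl x + cl y.
Proof. exact/esym/psq_addE. Qed.
Lemma ps_classZ c x : cl (ps_scale S c x) = c *: cl x.
Proof. exact/esym/psq_scaleE. Qed.
Lemma ps_classN x : cl (ps_opp S x) = - cl x.
Proof. exact/esym/psq_oppE. Qed.
Lemma ps_classM x y : cl (ps_mul S x y) = sa_mul (cl x) (cl y).
Proof. exact/esym/psq_mulE. Qed.
Lemma ps_classS x : cl (ps_star S x) = sa_star (cl x).
Proof. exact/esym/psq_starE. Qed.

End ClassMorphism.

Section Evaluation.
Variables (K : fieldType) (conj : fieldInvolution K) (X : Type).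
Variables (A : starAlgebra conj) (rho : X -> A).

Fixpoint term_eval (t : starTerm K X) : A :=
  match t with
  | TGen x => rho x
  | TZero => 0
  | TOpp t => - term_eval t
  | TAdd t t' => term_eval t + term_eval t'
  | TScale c t => c *: term_eval t
  | TMul t t' => sa_mul (term_eval t) (term_eval t')
  | TStar t => sa_star (term_eval t)
  end.

Lemma term_eval_sum (I : Type) (r : seq I) (P : pred I)
    (G : I -> starTerm K X) :
  term_eval (\big[@TAdd _ _/TZero]_(i <- r | P i) G i) =
    \sum_(i <- r | P i) term_eval (G i).
Proof. exact: (big_morph term_eval). Qed.

Lemma term_eval_congr (R : starTerm K X -> starTerm K X -> Prop) :
    (forall t t', R t t' -> term_eval t = term_eval t') ->
  forall t t', starCongr conj R t t' -> term_eval t = term_eval t'.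
Proof.
move=> Rt t t'; elim=> /= {t t'}; intros; try by [apply: Rt|congruence].
- exact: addrA.
- exact: addrC.
- exact: add0r.
- exact: addNr.
- exact: scalerA.
- exact: scale1r.
- exact: scalerDr.
- exact: scalerDl.
- exact: sa_mulA.
- exact: sa_mulDl.
- exact: sa_mulDr.
- exact: sa_mulZl.
- exact: sa_mulZr.
- exact: sa_starK.
- exact: sa_starD.
- exact: sa_starM.
- exact: sa_starZ.
Qed.

End Evaluation.

(** * The universal property of the abelianized Leavitt path algebra *)

Section Families.
Variables (K : fieldType) (conj : fieldInvolution K) (E : finWeightedGraph).
Variable A : starAlgebra conj.
Local Notation term := (starTerm K (gvert E + wsym E)%type).

Inductive star_semigroup (X : Type) (s : X -> A) : A -> Prop :=
| sg_gen x : star_semigroup s (s x)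
| sg_mul a b :
    star_semigroup s a -> star_semigroup s b -> star_semigroup s (sa_mul a b)
| sg_star a : star_semigroup s a -> star_semigroup s (sa_star a).

(** The data that a homomorphism out of the abelianized algebra amounts to: the
relations of [L_1], and commuting range projections for the semigroup
generated by the symbols. *)
Record abFamily := AbFamily {
  fam_v : gvert E -> A;
  fam_s : wsym E -> A;
  fam_gen := fun z => match z with inl v => fam_v v | inr x => fam_s x end;
  fam_rel : forall t t' : term, L1_rel t t' ->
    term_eval fam_gen t = term_eval fam_gen t';
  fam_comm : forall a b, star_semigroup fam_s a -> star_semigroup fam_s b ->
    sa_mul (sa_mul a (sa_star a)) (sa_mul b (sa_star b)) =
    sa_mul (sa_mul b (sa_star b)) (sa_mul a (sa_star a)) }.

(** Generation of a star-algebra, in the form in which it is used: induction on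
elements. *)
Definition generating (f : abFamily) : Prop := forall P : A -> Prop,
    (forall v, P (fam_v f v)) -> (forall x, P (fam_s f x)) ->
    P 0 -> (forall a, P a -> P (- a)) ->
    (forall a b, P a -> P b -> P (a + b)) ->
    (forall c a, P a -> P (c *: a)) ->
    (forall a b, P a -> P b -> P (sa_mul a b)) ->
    (forall a, P a -> P (sa_star a)) ->
  forall a, P a.

End Families.

Section LeavittUniversal.
Variables (K : fieldType) (conj : fieldInvolution K) (E : finWeightedGraph).
Local Notation L1 := (L1 conj E).
Local Notation Lab := (Lab conj E).
Local Notation term := (starTerm K (gvert E + wsym E)%type).

Local Notation cl1 := (ps_class (presented_pre conj (@L1_rel K E)) :
  term -> L1).
Local Notation cl2 := (ps_class (idealq_pre (Jab conj E)) : L1 -> Lab).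

Definition lab_term (t : term) : Lab := cl2 (cl1 t).

Definition lab_vert (v : gvert E) : Lab := lab_term (tvert K v).
Definition lab_sym (x : wsym E) : Lab := lab_term (tsym K x).

Let cl2D a b : cl2 (a + b) = cl2 a + cl2 b. Proof. exact: ps_classD. Qed.
Let cl2N a : cl2 (- a) = - cl2 a. Proof. exact: ps_classN. Qed.
Let cl2Z c a : cl2 (c *: a) = c *: cl2 a. Proof. exact: ps_classZ. Qed.
Let cl2M a b : cl2 (sa_mul a b) = sa_mul (cl2 a) (cl2 b).
Proof. exact: ps_classM. Qed.
Let cl2S a : cl2 (sa_star a) = sa_star (cl2 a). Proof. exact: ps_classS. Qed.
Let cl1D s t : cl1 (TAdd s t) = cl1 s + cl1 t. Proof. exact: ps_classD. Qed.
Let cl1N t : cl1 (TOpp t) = - cl1 t. Proof. exact: ps_classN. Qed.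
Let cl1Z c t : cl1 (TScale c t) = c *: cl1 t. Proof. exact: ps_classZ. Qed.
Let cl1M s t : cl1 (TMul s t) = sa_mul (cl1 s) (cl1 t).
Proof. exact: ps_classM. Qed.
Let cl1S t : cl1 (TStar t) = sa_star (cl1 t). Proof. exact: ps_classS. Qed.

Lemma lab_termE t :
  lab_term t =
  term_eval (fun z => match z with inl v => lab_vert v | inr x => lab_sym x end)
    t.
Proof.
elim: t => [[]||t IH|s IHs t IHt|c t IH|s IHs t IHt|t IH] //=.
- by rewrite -IH /lab_term cl1N cl2N.
- by rewrite -IHs -IHt /lab_term cl1D cl2D.
- by rewrite -IH /lab_term cl1Z cl2Z.
- by rewrite -IHs -IHt /lab_term cl1M cl2M.
- by rewrite -IH /lab_term cl1S cl2S.
Qed.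

Lemma lab_term_surj a : exists t, a = lab_term t.
Proof.
exists (ps_repr (ps_repr a : L1)).
by rewrite /lab_term !ps_reprK.
Qed.

Lemma in_U_lift a :
  star_semigroup lab_sym a -> exists2 u : L1, in_U u & a = cl2 u.
Proof.
elim=> {a} [x|a b _ [u Uu ->] _ [v Uv ->]|a _ [u Uu ->]].
- by exists (L1_sym conj x); [exact: U_sym|].
- by exists (sa_mul u v); [exact: U_mul|rewrite cl2M].
- by exists (sa_star u); [exact: U_star|rewrite cl2S].
Qed.

Definition lab_family : abFamily E Lab.
Proof.
apply: (@AbFamily _ _ _ _ lab_vert lab_sym) => [t t' tt'|a b].
  by rewrite -!lab_termE; congr ps_class; apply/ps_classP/sc_rel.
move=> /in_U_lift[u Uu ->] /in_U_lift[v Uv ->].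
rewrite -!cl2S -!cl2M; apply/ps_classP.
by apply: ig_mem; exists u, v.
Defined.

Lemma lab_generating : generating lab_family.
Proof.
move=> P Pv Ps P0 PN PD PZ PM PS a; have [t ->] := lab_term_surj a.
rewrite lab_termE.
elim: t => [[]||t IH|s IHs t IHt|c t IH|s IHs t IHt|t IH] //=.
- exact: PN.
- exact: PD.
- exact: PZ.
- exact: PM.
- exact: PS.
Qed.

Section Lift.
Variables (A : starAlgebra conj) (f : abFamily E A).
Local Notation ev := (term_eval (fam_gen f)).

Let lift1 (q : L1) : A := ev (ps_repr q).

Let lift1E t : lift1 (cl1 t) = ev t.
Proof.
exact/(term_eval_congr (fam_rel f))/(ps_repr_class (presented_pre _ _)).
Qed.

Let lift1D a b : lift1 (a + b) = lift1 a + lift1 b.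
Proof.
elim/ps_quotW: a => a; elim/ps_quotW: b => b.
by rewrite -cl1D !lift1E.
Qed.

Let lift1Z c a : lift1 (c *: a) = c *: lift1 a.
Proof. by elim/ps_quotW: a => a; rewrite -cl1Z !lift1E. Qed.

Let lift1M a b : lift1 (sa_mul a b) = sa_mul (lift1 a) (lift1 b).
Proof.
elim/ps_quotW: a => a; elim/ps_quotW: b => b.
by rewrite -cl1M !lift1E.
Qed.

Let lift1S a : lift1 (sa_star a) = sa_star (lift1 a).
Proof. by elim/ps_quotW: a => a; rewrite -cl1S !lift1E. Qed.

Let lift1_U u : in_U u -> star_semigroup (fam_s f) (lift1 u).
Proof.
elim=> {u} [x|a b _ IHa _ IHb|a _ IH]; first by rewrite lift1E; apply: sg_gen.
  by rewrite lift1M; apply: sg_mul.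
by rewrite lift1S; apply: sg_star.
Qed.

Let lift1_J a : si_mem (Jab conj E) a -> lift1 a = 0.
Proof.
have l0 : lift1 0 = 0 by rewrite -(scale0r 0) lift1Z scale0r.
elim=> {a} [a [u [v [Uu Uv ->]]]|//|a b _ a0 _ b0|c a _ a0|a b _ b0|a b _ b0].
- rewrite /sa_comm lift1D -scaleN1r lift1Z scaleN1r !lift1M !lift1S.
  by rewrite (@fam_comm _ _ _ _ f) ?subrr //; apply: lift1_U.
- by rewrite lift1D a0 b0 addr0.
- by rewrite lift1Z a0 scaler0.
- by rewrite lift1M b0 sa_mul0r.
- by rewrite lift1M b0 sa_mul0l.
Qed.

(** The evaluation of terms respects the relations, so it factors through
[L_1]; commutation of the range projections makes it vanish on the ideal of
commutators. *)
Lemma lab_lift : exists phi : {linear Lab -> A},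
  [/\ {morph phi : a b / sa_mul a b}, {morph phi : a / sa_star a},
      forall v, phi (lab_vert v) = fam_v f v &
      forall x, phi (lab_sym x) = fam_s f x].
Proof.
pose phi (q : Lab) : A := lift1 (ps_repr q).
have phiE a : phi (cl2 a) = lift1 a.
  have /lift1_J := ps_repr_class (idealq_pre (Jab conj E)) a.
  rewrite lift1D -scaleN1r lift1Z scaleN1r => /eqP; rewrite subr_eq0 => /eqP.
  exact.
have clP (a : Lab) : exists a', a = cl2 a'.
  by exists (ps_repr a); rewrite ps_reprK.
have phi_lin : linear phi.
  move=> c a b; have [a' ->] := clP a; have [b' ->] := clP b.
  by rewrite -cl2Z -cl2D !phiE lift1D lift1Z.
have phiM a b : phi (sa_mul a b) = sa_mul (phi a) (phi b).
  by have [a' ->] := clP a; have [b' ->] := clP b; rewrite -cl2M !phiE lift1M.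
have phiS a : phi (sa_star a) = sa_star (phi a).
  by have [a' ->] := clP a; rewrite -cl2S !phiE lift1S.
pose lin := GRing.isLinear.Build K Lab A *:%R phi phi_lin.
exists (HB.pack_for {linear Lab -> A} phi lin); split=> [||v|x].
- exact: phiM.
- exact: phiS.
- by rewrite [LHS]phiE lift1E.
- by rewrite [LHS]phiE lift1E.
Qed.

End Lift.

End LeavittUniversal.

(** * The partial representation of the free group *)

Section PartialRepresentation.
Variables (K : fieldType) (conj : fieldInvolution K) (E : finWeightedGraph).
Variables (A : starAlgebra conj) (f : abFamily E A).
Hypothesis f_gen : generating f.
Local Notation F := (freeGroup (wsym E)).
Local Notation uvert := (fam_v f).
Local Notation usym := (fam_s f).
Local Notation st := (@sa_star _ _ A).
Local Notation "a ** b" := (@sa_mul _ _ A a b) (at level 40,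
  left associativity).

Lemma uvertM u v : uvert u ** uvert v = if u == v then uvert u else 0.
Proof. by have /= -> := fam_rel f (L1_vertM K u v); case: ifP. Qed.

Lemma uvert_star v : st (uvert v) = uvert v.
Proof. by have /= <- := fam_rel f (L1_vert_star K v). Qed.

Definition uletter (l : letter E) : A :=
  if l.2 then usym l.1 else st (usym l.1).

Lemma uletter_star l : st (uletter l) = uletter (linv l).
Proof. by case: l => x [] //; rewrite /uletter /= sa_starK. Qed.

Lemma uvert_uletter l : uvert (lvert l) ** uletter l = uletter l.
Proof.
case: l => x [].
  by have := fam_rel f (L1_src K x).
have := fam_rel f (L1_rng K x); rewrite /= => xE.
by rewrite /uletter /= [in RHS]xE sa_starM uvert_star.
Qed.

Lemma uletter_orth l m : lclass l = lclass m -> l != m ->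
  st (uletter l) ** uletter m = 0.
Proof.
case: l m => [[e i] []] [[e' j] []] //= [].
  rewrite /uletter /= => ee ij nxy.
  have ne : e <> e'.
    move=> ee'; move: nxy; move: j ij; rewrite -ee' => j ij /eqP; apply.
    by congr (Tagged _ _, _); apply: val_inj.
  exact: (fam_rel f (L1_orth_edge K ee ne ij)).
move=> ee; move: j; rewrite -ee => j nij; rewrite /uletter /= sa_starK.
have ne : i <> j by move=> ij; move: nij; rewrite ij eqxx.
exact: (fam_rel f (L1_orth_index K ne)).
Qed.

(** The two families of summation relations, in common form. *)
Lemma uvert_class v c : class_at v c ->
  uvert v =
  \sum_(l : wsym E * bool | lclass l == c) uletter l ** st (uletter l).
Proof.
case: c => [[w i]|e] /=.
  case/andP=> /eqP -> iv; rewrite sum_class_src.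
  by have /= <- := fam_rel f (L1_sum_src K iv); rewrite term_eval_sum.
move=> /eqP <-; rewrite sum_class_rng.
have /= <- := fam_rel f (L1_sum_rng K e); rewrite term_eval_sum.
by apply: eq_bigr => i _; rewrite /uletter /= sa_starK.
Qed.

(** Algebras need not have a unit. The sum of the vertices is one as soon as
the family generates. *)
Definition uone : A := \sum_v uvert v.

Lemma uone_star : st uone = uone.
Proof. by rewrite sa_star_sum; apply: eq_bigr => v _; rewrite uvert_star. Qed.

Lemma uvert_uone v : uone ** uvert v = uvert v.
Proof.
rewrite sa_mul_suml (bigD1 v) //= uvertM eqxx big1 ?addr0 // => w wv.
by rewrite uvertM (negPf wv).
Qed.

Lemma uone_uletter l : uone ** uletter l = uletter l.
Proof. by rewrite -uvert_uletter sa_mulA uvert_uone. Qed.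

Lemma uone_neutral a : uone ** a = a /\ a ** uone = a.
Proof.
elim/f_gen: a =>
  [v|x||a [l r]|a b [l r] [l' r']|c a [l r]|a b [l r] [l' r']|a [l r]].
- have v1 := uvert_uone v; split=> //.
  by have := congr1 st v1; rewrite sa_starM uone_star uvert_star.
- have x1 := uone_uletter (x, true); split=> //.
  have := congr1 st (uone_uletter (x, false)).
  by rewrite sa_starM uone_star uletter_star.
- by rewrite sa_mul0l sa_mul0r.
- by rewrite sa_mulNl sa_mulNr l r.
- by rewrite sa_mulDl sa_mulDr l r l' r'.
- by rewrite sa_mulZl sa_mulZr l r.
- by rewrite sa_mulA l -sa_mulA r'.
- by rewrite -uone_star -!sa_starM l r.
Qed.

Lemma uonel a : uone ** a = a. Proof. by case: (uone_neutral a). Qed.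
Lemma uoner a : a ** uone = a. Proof. by case: (uone_neutral a). Qed.

Definition uword (w : seq (letter E)) : A :=
  foldr (fun l a => uletter l ** a) uone w.
Definition ugroup (g : F) : A := uword (fword g).

Lemma uword_cat u w : uword (u ++ w) = uword u ** uword w.
Proof. by elim: u => [|l u /= ->]; rewrite ?uonel ?sa_mulA. Qed.

Lemma ugroup1 : ugroup 1%g = uone. Proof. by []. Qed.

Lemma ugroup_letter l : ugroup (fg_letter l) = uletter l.
Proof. exact: uoner. Qed.

Lemma ugroup_star g : st (ugroup g) = ugroup g^-1%g.
Proof.
rewrite /ugroup -[fword g^-1%g]/(Defs.finv (fword g)).
elim: (fword g) => [|l w IH]; first exact: uone_star.
rewrite /Defs.finv /= rev_cons -cats1 uword_cat -IH sa_starM /= uoner.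
by rewrite uletter_star.
Qed.

(** Locked, because rewriting with associativity would otherwise see through
the product. *)
Definition urange (g : F) : A := locked (ugroup g ** st (ugroup g)).

Lemma urangeE g : urange g = ugroup g ** st (ugroup g).
Proof. by rewrite /urange -lock. Qed.

Lemma urange1 : urange 1%g = uone.
Proof. by rewrite urangeE ugroup1 uonel uone_star. Qed.

Lemma urange_star g : st (urange g) = urange g.
Proof. by rewrite urangeE sa_starM sa_starK. Qed.

Lemma ugroup_semigroup g : g = 1%g \/ star_semigroup usym (ugroup g).
Proof.
have Ul l : star_semigroup usym (uletter l).
  by case: l => x []; [apply: sg_gen|apply/sg_star/sg_gen].
elim/fg_ind: g => [|l g rg [->|Ug]]; first by left.
  by right; rewrite mulg1 ugroup_letter.
by right; rewrite /ugroup fg_letter_mul //=; apply: sg_mul.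
Qed.

Lemma urange_comm g h : urange g ** urange h = urange h ** urange g.
Proof.
case: (ugroup_semigroup g) => [->|Ug]; first by rewrite urange1 uonel uoner.
case: (ugroup_semigroup h) => [->|Uh]; first by rewrite urange1 uonel uoner.
by rewrite !urangeE (fam_comm Ug Uh).
Qed.

(** Multiply the summation relation of the class of [l] by the letter: the
other summands vanish by orthogonality. *)
Lemma uletter_pisom l : uletter l ** st (uletter l) ** uletter l = uletter l.
Proof.
have := uvert_uletter l; rewrite {1}(uvert_class (class_at_lclass l))
  sa_mul_suml.
rewrite (bigD1 l) //= big1 ?addr0 // => m /andP[/eqP ml mNl].
by rewrite -sa_mulA uletter_orth // sa_mul0r.
Qed.

Lemma urange_letter l : urange (fg_letter l) = uletter l ** st (uletter l).
Proof. by rewrite urangeE ugroup_letter. Qed.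

(** The initial projection of a letter is the range projection of its inverse,
so it commutes with all range projections. *)
Lemma uletter_urange l g :
  uletter l ** urange g = uletter l ** urange g ** st (uletter l) ** uletter l.
Proof.
have lE : st (uletter l) ** uletter l = urange (fg_letter (linv l)).
  by rewrite urange_letter -uletter_star sa_starK.
rewrite -[in LHS](uletter_pisom l) -!sa_mulA; congr (_ ** _).
by rewrite [LHS]sa_mulA lE urange_comm.
Qed.

(** A product of two partial isometries is a partial isometry when the initial
projection of the first commutes with the range projection of the second. *)
Lemma urange_ugroup g : urange g ** ugroup g = ugroup g.
Proof.
elim/fg_ind: g => [|l g rg IH]; first by rewrite urange1 uonel.
have lgE : ugroup (fg_letter l * g)%g = uletter l ** ugroup g.
  by rewrite /ugroup fg_letter_mul.
rewrite urangeE lgE.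
transitivity (uletter l ** urange g ** st (uletter l) ** uletter l ** ugroup g).
  by rewrite urangeE sa_starM !sa_mulA.
by rewrite -uletter_urange -sa_mulA IH.
Qed.

(** When [l] cancels the first letter of [g], this is the definition of the
range projection of [l]; otherwise both sides are [u_(l g)]. *)
Lemma uletter_ugroup l g :
  uletter l ** ugroup g = urange (fg_letter l) ** ugroup (fg_letter l * g)%g.
Proof.
have [rg|/fg_letter_reducedP[h -> rh]] := boolP (reduced (l :: fword g)).
  by rewrite /ugroup fg_letter_mul //= urange_letter sa_mulA uletter_pisom.
rewrite fg_letterVK {1}/ugroup fg_letter_mul //= urange_letter uletter_star.
by rewrite sa_mulA.
Qed.

Lemma urange_idem g : urange g ** urange g = urange g.
Proof. by rewrite {2}urangeE sa_mulA urange_ugroup -urangeE. Qed.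

Lemma urange_reduced l g : reduced (l :: fword g) ->
  urange (fg_letter l) ** urange (fg_letter l * g)%g =
  urange (fg_letter l * g)%g.
Proof.
move=> rg; rewrite [urange (fg_letter l * g)%g]urangeE sa_mulA; congr (_ ** _).
by rewrite /ugroup fg_letter_mul //= sa_mulA urange_letter uletter_pisom.
Qed.

Lemma uletter_conj l g :
  uletter l ** urange g ** st (uletter l) =
  urange (fg_letter l) ** urange (fg_letter l * g)%g.
Proof.
have -> : uletter l ** urange g ** st (uletter l) =
  uletter l ** ugroup g ** st (uletter l ** ugroup g).
  by rewrite urangeE sa_starM !sa_mulA.
rewrite uletter_ugroup sa_starM urange_star sa_mulA.
rewrite -[_ ** _ ** st _]sa_mulA -urangeE.
by rewrite urange_comm -sa_mulA urange_idem.
Qed.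

Lemma uletter_urangeE l g :
  uletter l ** urange g =
  urange (fg_letter l) ** urange (fg_letter l * g)%g ** uletter l.
Proof. by rewrite uletter_urange uletter_conj. Qed.

(** The words form a partial representation of the free group, the algebraic
counterpart of a partial action. *)
Lemma ugroup_mul g h : ugroup g ** ugroup h = urange g ** ugroup (g * h)%g.
Proof.
elim/fg_ind: g => [|l g rg IH]; first by rewrite urange1 ugroup1 !uonel.
have -> : ugroup (fg_letter l * g)%g = uletter l ** ugroup g.
  by rewrite /ugroup fg_letter_mul.
rewrite -sa_mulA IH sa_mulA uletter_urangeE -sa_mulA uletter_ugroup.
rewrite urange_reduced // sa_mulA [_ ** urange (fg_letter l)]urange_comm.
by rewrite urange_reduced // mulgA.
Qed.

Lemma ugroup_conj g h :
  ugroup g ** urange h ** st (ugroup g) = urange g ** urange (g * h)%g.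
Proof.
have -> : ugroup g ** urange h ** st (ugroup g) =
  ugroup g ** ugroup h ** st (ugroup g ** ugroup h).
  by rewrite urangeE sa_starM !sa_mulA.
rewrite ugroup_mul sa_starM urange_star sa_mulA.
rewrite -[_ ** _ ** st _]sa_mulA -urangeE.
by rewrite urange_comm -sa_mulA urange_idem.
Qed.

Lemma urange_prefix g h : prefix (fword g) (fword h) ->
  urange g ** urange h = urange h.
Proof.
move=> /prefixP[t hE]; rewrite [urange h]urangeE sa_mulA; congr (_ ** _).
by rewrite /ugroup hE uword_cat sa_mulA -/(ugroup g) urange_ugroup.
Qed.

(** The diagonal: its elements go to functions on the space of configurations
placed in degree [1]. *)
Inductive in_diag : A -> Prop :=
| in_diag_p g : in_diag (urange g)
| in_diag_0 : in_diag 0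
| in_diag_add a b : in_diag a -> in_diag b -> in_diag (a + b)
| in_diag_scale c a : in_diag a -> in_diag (c *: a)
| in_diag_mul a b : in_diag a -> in_diag b -> in_diag (a ** b).

Lemma in_diag_sum (I : Type) (r : seq I) (P : pred I) (G : I -> A) :
  (forall i, P i -> in_diag (G i)) -> in_diag (\sum_(i <- r | P i) G i).
Proof.
by move=> BG; apply: big_ind => //; [apply: in_diag_0|apply: in_diag_add].
Qed.

Lemma in_diag_opp a : in_diag a -> in_diag (- a).
Proof. by rewrite -scaleN1r; apply: in_diag_scale. Qed.

Lemma in_diag_comm a b : in_diag a -> in_diag b -> a ** b = b ** a.
Proof.
move=> Ba Bb; elim: Ba => {a} [g||a a' _ IH _ IH'|c a _ IH|a a' _ IH _ IH'].
- elim: Bb => {b} [h||b b' _ IH _ IH'|c b _ IH|b b' _ IH _ IH'].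
  + exact: urange_comm.
  + by rewrite sa_mul0l sa_mul0r.
  + by rewrite sa_mulDl sa_mulDr IH IH'.
  + by rewrite sa_mulZl sa_mulZr IH.
  + by rewrite sa_mulA IH -sa_mulA IH' sa_mulA.
- by rewrite sa_mul0l sa_mul0r.
- by rewrite sa_mulDl sa_mulDr IH IH'.
- by rewrite sa_mulZl sa_mulZr IH.
- by rewrite -sa_mulA IH' sa_mulA IH sa_mulA.
Qed.

Lemma urange_class v c : class_at v c ->
  uvert v = \sum_(l : wsym E * bool | lclass l == c) urange (fg_letter l).
Proof.
by move=> /uvert_class ->; apply: eq_bigr => l _; rewrite urange_letter.
Qed.

Lemma in_diag_uvert v : in_diag (uvert v).
Proof.
have [c /urange_class ->] := class_at_exists v.
by apply: in_diag_sum => l _; apply: in_diag_p.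
Qed.

Lemma in_diag_1 : in_diag uone.
Proof. by apply: in_diag_sum => v _; apply: in_diag_uvert. Qed.

Lemma uletter_in_diag l b : in_diag b ->
  exists2 b', in_diag b' & uletter l ** b = b' ** uletter l.
Proof.
elim=> {b} [g||a b _ [a' Ba' aE] _ [b' Bb' bE]|c a _ [a' Ba' aE]
            |a b _ [a' Ba' aE] _ [b' Bb' bE]].
- exists (urange (fg_letter l) ** urange (fg_letter l * g)%g);
    last exact: uletter_urangeE.
  by apply: in_diag_mul; apply: in_diag_p.
- by exists 0; [exact: in_diag_0|rewrite sa_mul0l sa_mul0r].
- by exists (a' + b'); [exact: in_diag_add|rewrite sa_mulDl sa_mulDr aE bE].
- by exists (c *: a'); [exact: in_diag_scale|rewrite sa_mulZl sa_mulZr aE].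
- exists (a' ** b'); first exact: in_diag_mul.
  by rewrite sa_mulA aE -sa_mulA bE sa_mulA.
Qed.

Definition graded (a : A) : Prop := exists s : seq (F * A),
  (forall x, x \in s -> in_diag x.2) /\ a = \sum_(x <- s) x.2 ** ugroup x.1.

Lemma graded_mono b g : in_diag b -> graded (b ** ugroup g).
Proof.
move=> Bb; exists [:: (g, b)]; split; last by rewrite big_seq1.
by move=> x; rewrite inE => /eqP ->.
Qed.

Lemma graded0 : graded 0.
Proof. by exists [::]; rewrite big_nil. Qed.

Lemma gradedD a b : graded a -> graded b -> graded (a + b).
Proof.
move=> [s [Bs ->]] [t [Bt ->]]; exists (s ++ t); split; last by rewrite big_cat.
by move=> x; rewrite mem_cat => /orP[/Bs|/Bt].
Qed.

Lemma graded_mul a (m : A) :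
  (forall b g, in_diag b -> graded (m ** (b ** ugroup g))) ->
  graded a -> graded (m ** a).
Proof.
move=> Gm [s [Bs ->]]; rewrite sa_mul_sumr big_seq.
by apply: big_ind => [||x /Bs Bx]; [exact: graded0|exact: gradedD|exact: Gm].
Qed.

Lemma gradedZ c a : graded a -> graded (c *: a).
Proof.
move=> Ga; rewrite -[a]uonel -sa_mulZl; apply: graded_mul Ga => b g Bb.
by rewrite sa_mulZl uonel -sa_mulZl; apply/graded_mono/in_diag_scale.
Qed.

Lemma graded_uletter l a : graded a -> graded (uletter l ** a).
Proof.
apply: graded_mul => b g Bb; have [b' Bb' bE] := uletter_in_diag l Bb.
rewrite sa_mulA bE -sa_mulA uletter_ugroup sa_mulA.
by apply/graded_mono/in_diag_mul => //; apply: in_diag_p.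
Qed.

(** The elements that, together with their adjoints, preserve graded elements
under left multiplication form a star-subalgebra that contains the generators;
apply this to the unit, which is graded. *)
Lemma graded_all a : graded a.
Proof.
suff [Ga _] : (forall s, graded s -> graded (a ** s)) /\
             (forall s, graded s -> graded (st a ** s)).
  rewrite -[a]uoner; apply: Ga; rewrite -[uone]uonel.
  exact: (graded_mono 1%g in_diag_1).
elim/f_gen: a =>
  [v|x||a [l r]|a b [l r] [l' r']|c a [l r]|a b [l r] [l' r']|a [l r]].
- suff vG s : graded s -> graded (uvert v ** s) by rewrite uvert_star.
  apply: graded_mul => b g Bb; rewrite sa_mulA.
  by apply/graded_mono/in_diag_mul => //; apply: in_diag_uvert.
- split=> s; first exact: (@graded_uletter (x, true)).
  exact: (@graded_uletter (x, false)).
- by rewrite sa_star0; split=> s _; rewrite sa_mul0l; apply: graded0.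
- split=> s Gs; rewrite -?scaleN1r ?sa_starZ sa_mulZl; apply: gradedZ; auto.
- by split=> s Gs; rewrite ?sa_starD sa_mulDl; apply: gradedD; auto.
- by split=> s Gs; rewrite ?sa_starZ sa_mulZl; apply: gradedZ; auto.
- by split=> s Gs; rewrite ?sa_starM -sa_mulA; auto.
- by rewrite sa_starK.
Qed.

(** * Points of the spectrum of the diagonal *)

Definition eigen (S : seq F) (xi : F -> bool) (r : A) : Prop :=
  forall g, g \in S -> urange g ** r = if xi g then r else 0.

(** Write [r] as [p_g r] plus [r - p_g r] and keep a summand that does not
annihilate [q]. *)
Lemma eigen_exists (q : A) (S : seq F) : q <> 0 ->
  exists xi r, [/\ in_diag r, r ** q <> 0 & eigen S xi r].
Proof.
move=> q0; suff [r [Br rq rS]] : exists r, [/\ in_diag r, r ** q <> 0 &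
    forall g, g \in S -> urange g ** r = r \/ urange g ** r = 0].
  exists (fun g => `[< urange g ** r = r >]), r; split=> // g gS.
  by case: asboolP => // n; case: (rS g gS).
elim: S => [|g S [r [Br rq rS]]].
  by exists uone; split=> //; [exact: in_diag_1|rewrite uonel].
have cg h : urange h ** (urange g ** r) = urange g ** (urange h ** r).
  by rewrite !sa_mulA; congr (_ ** _); apply: urange_comm.
have gg : urange g ** (urange g ** r) = urange g ** r.
  by rewrite sa_mulA urange_idem.
have [gr|gr] := pselect (urange g ** r ** q = 0).
  exists (r - urange g ** r); split.
  - by apply: in_diag_add => //; apply/in_diag_opp/in_diag_mul => //;
      apply: in_diag_p.
  - by rewrite sa_mulBl gr subr0.
  - move=> h; rewrite inE => /predU1P[->|/rS[] hr]; rewrite sa_mulBr.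
    + by rewrite gg subrr; right.
    + by rewrite cg hr; left.
    + by rewrite cg hr sa_mul0r subrr; right.
exists (urange g ** r); split=> //.
  by apply: in_diag_mul => //; apply: in_diag_p.
move=> h; rewrite inE => /predU1P[->|/rS[] hr]; rewrite ?gg ?cg ?hr; auto.
by right; rewrite sa_mul0r.
Qed.

(** The sets of words that serve for a given [S] form a filter base as [S]
grows. The limit of a finer ultrafilter agrees on [S] with a member of the set
belonging to [S], so it serves for every [S]. *)
Lemma eigen_limit (q : A) : q <> 0 ->
  exists xi : F -> bool,
    forall S, exists r, [/\ in_diag r, r ** q <> 0 & eigen S xi r].
Proof.
move=> q0.
pose W (S : seq F) := [set xi : F -> bool |
  exists r, [/\ in_diag r, r ** q <> 0 & eigen S xi r]].
have FW : ProperFilter (filter_from [set: seq F] W).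
  apply: filter_from_proper; last first.
    by move=> S _; have [xi [r rP]] := eigen_exists S q0; exists xi, r.
  apply: filter_from_filter; first by exists [::].
  move=> S S' _ _; exists (S ++ S') => // xi [r [Br rq rS]].
  by split; exists r; split=> // g gS; apply: rS; rewrite mem_cat gS ?orbT.
have [U [UU WU]] := ultraFilterLemma FW.
exists (ulim U id) => S.
have WS : U (W S) by apply: WU; exists S.
have [zeta [[r [Br rq rS]] zS]] := filter_ex (filterI WS (ulim_near id S UU)).
by exists r; split=> // g gS; rewrite rS // zS.
Qed.

(** The initial projection of [u_g] is in the diagonal, so it can be moved past
[a] and absorbed. *)
Lemma ugroup_conjM g a b : in_diag a -> in_diag b ->
  (ugroup g ** a ** st (ugroup g)) ** (ugroup g ** b ** st (ugroup g)) =
  ugroup g ** (a ** b) ** st (ugroup g).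
Proof.
move=> Ba Bb; have gE : st (ugroup g) ** ugroup g = urange g^-1%g.
  by rewrite urangeE -ugroup_star sa_starK.
transitivity (ugroup g ** (a ** urange g^-1%g ** b) ** st (ugroup g)).
  by rewrite -gE !sa_mulA.
have -> : a ** urange g^-1%g = urange g^-1%g ** a.
  by apply: in_diag_comm => //; apply: in_diag_p.
rewrite -gE !sa_mulA -urangeE; congr (_ ** _ ** _ ** _).
exact: urange_ugroup.
Qed.

(** Each condition on a configuration is an identity between finitely many
range projections; applied to a common nonzero eigenvector it becomes the same
condition on the eigenvalues. *)
Lemma eigen_config (q : A) : q <> 0 -> exists xi : config E,
  forall S, exists r, [/\ in_diag r, r ** q <> 0 & eigen S xi r].
Proof.
move=> /eigen_limit[xi xiP].
suff xic : is_config xi by exists (Config xic).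
have nz r : r ** q <> 0 -> r <> 0.
  by move=> rq r0; apply: rq; rewrite r0 sa_mul0l.
split.
- have [r [_ /nz r0 /(_ 1%g (mem_head _ _))]] := xiP [:: 1%g].
  by rewrite urange1 uonel //; case: (xi _).
- move=> g h gh xh; have [r [_ /nz r0 rS]] := xiP [:: g; h].
  have := rS g; have := rS h; rewrite !inE !eqxx orbT xh.
  move=> /(_ isT) hr /(_ isT).
  by rewrite -hr sa_mulA urange_prefix // hr; case: (xi g).
move=> g xg.
have [r [Br /nz r0 rS]] :=
  xiP (g :: [seq (g * fg_letter l)%g | l <- enum {: wsym E * bool}]).
have gr : urange g ** r = r by rewrite rS ?mem_head // xg.
have lr l : urange (g * fg_letter l)%g ** r =
    if xi (g * fg_letter l)%g then r else 0.
  by apply: rS; rewrite inE; apply/orP; right; apply: map_f; rewrite mem_enum.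
(* Conjugation by [u_g] moves the relations of [L_1] at a vertex, which
   involve the range projections of letters, to the words [g l]. *)
pose Q a := ugroup g ** a ** st (ugroup g).
have QM a b : in_diag a -> in_diag b -> Q a ** Q b = Q (a ** b).
  exact: ugroup_conjM.
have Ql l : Q (urange (fg_letter l)) ** r =
    if xi (g * fg_letter l)%g then r else 0.
  by rewrite /Q ugroup_conj -sa_mulA lr; case: ifP => _; rewrite ?gr ?sa_mul0r.
have Qr l : xi (g * fg_letter l)%g -> Q (urange (fg_letter l)) ** r = r.
  by rewrite Ql => ->.
(* The unit is the sum of the vertices and [Q] of it fixes [r], so some vertex
   does not annihilate [r]. *)
have [v vr] : exists v, Q (uvert v) ** r <> 0.
  apply: contrapT => nv; apply: r0.
  have <- : Q uone ** r = r by rewrite /Q uoner -urangeE.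
  rewrite /Q /uone sa_mul_sumr !sa_mul_suml big1 // => v _.
  by apply: contrapT => vr; apply: nv; exists v.
exists v; split=> [l xl|c cv|l m xl xm lm].
- apply: contrapT => lv; apply: vr; rewrite -(Qr l xl) sa_mulA QM.
  + suff -> : uvert v ** urange (fg_letter l) = 0.
      by rewrite /Q sa_mul0r !sa_mul0l.
    rewrite urange_letter // -(uvert_uletter l) !sa_mulA uvertM.
    by case: eqP => [vl|]; [case: lv|rewrite !sa_mul0l].
  + exact: in_diag_uvert.
  + exact: in_diag_p.
- apply: contrapT => nc; apply: vr; rewrite (urange_class cv).
  rewrite /Q sa_mul_sumr !sa_mul_suml big1 // => l /eqP lc; rewrite -/(Q _) Ql.
  by case: ifP => // xl; case: nc; exists l.
- apply/eqP; apply: contrapT => /negP nlm; apply: r0.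
  rewrite -(Qr l xl) -(Qr m xm) sa_mulA QM; [|exact: in_diag_p..].
  suff -> : urange (fg_letter l) ** urange (fg_letter m) = 0.
    by rewrite /Q sa_mul0r !sa_mul0l.
  rewrite !urange_letter // sa_mulA -[uletter l ** _ ** _]sa_mulA.
  by rewrite uletter_orth // sa_mul0r sa_mul0l.
Qed.

End PartialRepresentation.

(** * Elements of the crossed product *)

Section CrossedValues.
Variables (K : fieldType) (conj : fieldInvolution K).
Variables (G : groupType) (T : topologicalType) (th : partialAction G T).
Local Notation X := (crossed_product conj th).

Definition cval (a : X) : G -> T -> K := crossed_val a.
Arguments cval : simpl never.

Lemma cval_inj (a b : X) : (forall k x, cval a k x = cval b k x) -> a = b.
Proof.
move=> ab; apply: val_inj; apply/funext => k; apply/funext => x; exact: ab.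
Qed.

Lemma cvalD a b k x : cval (a + b) k x = cval a k x + cval b k x.
Proof. by []. Qed.

Lemma cval0 k x : cval 0 k x = 0.
Proof. by []. Qed.

Lemma cvalZ c a k x : cval (c *: a) k x = c * cval a k x.
Proof. by []. Qed.

Lemma cval_sum (I : Type) (r : seq I) (P : pred I) (H : I -> X) k x :
  cval (\sum_(i <- r | P i) H i) k x = \sum_(i <- r | P i) cval (H i) k x.
Proof. exact: (big_morph (fun a => cval a k x)). Qed.

Definition homogeneous (g : G) (a : X) : Prop :=
  forall k x, k != g -> cval a k x = 0.

(** A left factor concentrated in one degree leaves a single term of the
convolution. *)
Lemma cvalM g a b k x : homogeneous g a ->
  cval (sa_mul a b) k x =
  cval a g x * cval b (g^-1 * k)%g (pa_act th g^-1%g x).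
Proof.
move=> ag; rewrite [LHS](@crossed_mul_seq _ _ _ _ _ _ [fset g]%fset).
- by rewrite big_seq_fset1.
- exact: crossedP.
- by move=> h; rewrite inE => hg y; apply: ag.
Qed.

Lemma cvalS a k x :
  cval (sa_star a) k x = pa_fun th k (fun y => conj (cval a k^-1%g y)) x.
Proof. by []. Qed.

Lemma homogeneousM g h a b :
  homogeneous g a -> homogeneous h b -> homogeneous (g * h)%g (sa_mul a b).
Proof.
move=> ag bh k x kgh; rewrite (cvalM _ _ _ ag) bh ?mulr0 //.
by apply: contra kgh => /eqP <-; rewrite mulVKg.
Qed.

Lemma homogeneousS g a : homogeneous g a -> homogeneous g^-1%g (sa_star a).
Proof.
move=> ag k x kg; rewrite cvalS /pa_fun; case: ifP => // _.
by rewrite ag ?rmorph0 //; apply: contra kg => /eqP <-; rewrite invgK.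
Qed.

Lemma homogeneous1_comm a b : homogeneous 1%g a -> homogeneous 1%g b ->
  sa_mul a b = sa_mul b a.
Proof.
move=> a1 b1; apply: cval_inj => k x; rewrite (cvalM _ _ _ a1) (cvalM _ _ _ b1).
rewrite invg1 mul1g pa_act1 mulrC.
by have [->//|k1] := eqVneq k 1%g; rewrite (a1 k) // (b1 k) // mulr0 mul0r.
Qed.

(** Such range elements have degree [1], where the product is the pointwise
product of functions. *)
Lemma homogeneous_range_comm g h a b : homogeneous g a -> homogeneous h b ->
  sa_mul (sa_mul a (sa_star a)) (sa_mul b (sa_star b)) =
  sa_mul (sa_mul b (sa_star b)) (sa_mul a (sa_star a)).
Proof.
move=> ag bh; apply: homogeneous1_comm.
  by rewrite -(mulgV g); apply/homogeneousM/homogeneousS.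
by rewrite -(mulgV h); apply/homogeneousM/homogeneousS.
Qed.

Lemma is_crossed_mono g (h : T -> K) :
    (forall x, \forall y \near x, h y = h x) ->
    (forall x, ~ pa_dom th g x -> h x = 0) ->
  is_crossed th (fun k x => if k == g then h x else 0 : K^o).
Proof.
move=> hc hd; split=> [|k|k x xk].
- apply: (@sub_finite_set _ _ [set g]); last exact: finite_set1.
  move=> k /=; apply: contra_notP => /eqP/negPf kg; rewrite kg.
  exact/funext.
- apply/loc_constP => x; have [_|_] := eqVneq k g; first exact: hc.
  exact: nearW.
- by have [kg|//] := eqVneq k g; apply: hd; rewrite -kg.
Qed.

Definition cmono g h hc hd : X :=
  Crossed (asboolT (@is_crossed_mono g h hc hd)).

Lemma cval_mono g h hc hd k x :
  cval (@cmono g h hc hd) k x = if k == g then h x else 0.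
Proof. by []. Qed.

Lemma homogeneous_mono g h hc hd : homogeneous g (@cmono g h hc hd).
Proof. by move=> k x kg; rewrite cval_mono (negPf kg). Qed.

Lemma crossed_near (a : X) k x : \forall y \near x, cval a k y = cval a k x.
Proof. by have [_ + _] := crossedP a => /(_ k)/loc_constP/(_ x). Qed.

Lemma crossed_dom (a : X) k x : ~ pa_dom th k x -> cval a k x = 0.
Proof. by have [_ _] := crossedP a; apply. Qed.

End CrossedValues.

Arguments cval : simpl never.

(** * Generators of the crossed product of configurations *)

Section ConfigCrossed.
Variables (K : fieldType) (conj : fieldInvolution K) (E : finWeightedGraph).
Local Notation F := (freeGroup (wsym E)).
Local Notation config := (config E).
Local Notation th := (config_action E).
Local Notation X := (crossed_product conj th).
Local Notation st := (@sa_star _ _ X).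
Local Notation "a ** b" := (@sa_mul _ _ X a b) (at level 40,
  left associativity).

Lemma clopen_near (D : set config) : clopen D ->
  forall x, \forall y \near x, (`[< D y >]%:R : K) = (`[< D x >])%:R.
Proof.
move=> [oD cD] x; have [xD|xD] := pselect (D x).
  have nD : \forall y \near x, D y by apply: open_nbhs_nbhs.
  by apply: filterS nD => y yD; rewrite !asboolT.
have nD : \forall y \near x, (~` D) y.
  by apply: open_nbhs_nbhs; split=> //; apply: closed_openC.
by apply: filterS nD => y yD; rewrite !asboolF.
Qed.

(** [1_(Omega_v) delta_1]. *)
Definition cross_vert (v : gvert E) : X.
Proof.
apply: (@cmono _ conj _ _ th 1%g (fun x => (`[< cvert v x >])%:R)).
  exact/clopen_near/cvert_clopen.
by move=> x; case; case: (configP x).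
Defined.

(** [1_(dom g) delta_g]. *)
Definition cross_group (g : F) : X.
Proof.
apply: (@cmono _ conj _ _ th g (fun x : config => (x g)%:R)).
  by move=> x; apply: filterS (nbhs_config_at g x) => y ->.
by move=> x /negP/negPf; rewrite /cdom /= => ->.
Defined.

Lemma cval_cross_vert v k x :
  cval (cross_vert v) k x = ((k == 1%g) && `[< cvert v x >])%:R.
Proof. by rewrite cval_mono; case: ifP. Qed.

Lemma cval_cross_group g k x : cval (cross_group g) k x = ((k == g) && x g)%:R.
Proof. by rewrite cval_mono; case: ifP. Qed.

Lemma homogeneous_cross_vert v : homogeneous 1%g (cross_vert v).
Proof. exact: homogeneous_mono. Qed.

Lemma homogeneous_cross_group g : homogeneous g (cross_group g).
Proof. exact: homogeneous_mono. Qed.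

Lemma cval1M a b k (x : config) :
  homogeneous 1%g a -> cval (a ** b) k x = cval a 1%g x * cval b k x.
Proof. by move=> a1; rewrite (cvalM _ _ _ a1) invg1 mul1g pa_act1. Qed.

Lemma config1 (x : config) : x 1%g.
Proof. by case: (configP x). Qed.

Lemma cval_cross_groupM g h k x :
  cval (cross_group g ** cross_group h) k x =
    [&& k == (g * h)%g, x g & x (g * h)%g]%:R.
Proof.
rewrite (cvalM _ _ _ (@homogeneous_cross_group g)) !cval_cross_group eqxx /=.
have [xg|_] := boolP (x g); last by rewrite mul0r andbF.
by rewrite mul1r cshiftE invgK // (can2_eq (mulVKg g) (mulKg g)).
Qed.

Lemma cross_group_star g : st (cross_group g) = cross_group g^-1%g.
Proof.
apply: cval_inj => k x; rewrite cvalS cval_cross_group.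
have [xk|xk] := boolP (x k); last first.
  rewrite pa_fun0; last exact/negP.
  by have [<-|//] := eqVneq k g^-1%g; rewrite (negPf xk).
rewrite pa_funE // cval_cross_group (can2_eq invgK invgK).
have [kg|_] := eqVneq k g^-1%g.
  rewrite -[g]invgK -kg /= cshiftE ?invgK // mulgV config1 rmorph1.
  by rewrite xk.
by rewrite rmorph0.
Qed.

Lemma cross_group1 : cross_group 1%g = \sum_v cross_vert v.
Proof.
apply: cval_inj => k x; rewrite cval_cross_group config1 andbT cval_sum.
have [v xv] := cvert_exists x; rewrite (bigD1 v) //= [X in _ + X]big1 ?addr0.
  by rewrite cval_cross_vert asboolT // andbT.
move=> w wv; rewrite cval_cross_vert asboolF ?andbF // => xw.
by move/eqP: wv; apply; apply: cvert_inj xw xv.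
Qed.

(** The domain of [l g] lies in that of [l] since configurations are closed
under prefixes. *)
Lemma cross_groupM l g : reduced (l :: fword g) ->
  cross_group (fg_letter l) ** cross_group g = cross_group (fg_letter l * g)%g.
Proof.
move=> rg; apply: cval_inj => k x; rewrite cval_cross_groupM cval_cross_group.
have [_|//] := eqVneq k _.
have [xlg|_] := boolP (x (fg_letter l * g)%g); last by rewrite andbF.
suff -> : x (fg_letter l) by [].
case: (configP x) => _ xp _; apply: xp xlg.
by rewrite fg_letter_mul //= eqxx prefix0s.
Qed.

Lemma cross_group_range g k x :
  cval (cross_group g ** st (cross_group g)) k x = ((k == 1%g) && x g)%:R.
Proof. by rewrite cross_group_star cval_cross_groupM mulgV config1 andbT. Qed.

Lemma cross_vertM v a k x :
  cval (cross_vert v ** a) k x = (`[< cvert v x >])%:R * cval a k x.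
Proof.
by rewrite cval1M ?cval_cross_vert ?eqxx //; apply: homogeneous_cross_vert.
Qed.

Lemma cross_vert_star v : st (cross_vert v) = cross_vert v.
Proof.
apply: cval_inj => k x; rewrite cvalS /pa_fun.
have [->|k1] := eqVneq k 1%g; last first.
  rewrite !cval_cross_vert (negPf k1); case: ifP => // _.
  by rewrite (can2_eq invgK invgK) invg1 (negPf k1) rmorph0.
have x1 : pa_dom th 1%g x by apply: config1.
rewrite (mem_set x1) invg1 (pa_act1 th x).
by rewrite cval_cross_vert rmorph_nat.
Qed.

Lemma cross_vert_cross_group l :
  cross_vert (lvert l) ** cross_group (fg_letter l) = cross_group (fg_letter l).
Proof.
apply: cval_inj => k x; rewrite cross_vertM cval_cross_group.
have [xl|_] := boolP (x (fg_letter l)); last by rewrite andbF mulr0.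
by rewrite asboolT ?mul1r //; apply: cvert_letter.
Qed.

(** If both factors were nonzero at [x], the local rule of [x] at the word
[l^-1] would admit the letters [l] and [m] of the same class. *)
Lemma cross_group_orth l m : lclass l = lclass m -> l != m ->
  st (cross_group (fg_letter l)) ** cross_group (fg_letter m) = 0.
Proof.
move=> lm nlm; apply: cval_inj => k x.
rewrite cross_group_star cval_cross_groupM cval0.
have [_|//] := eqVneq k _; have [xl|//] := boolP (x _).
have [xm|//] := boolP (x _).
case: (configP x) => _ _ /(_ _ xl)[v [_ _ ru]].
by case/eqP: nlm; apply: ru => //; rewrite mulVg config1.
Qed.

Lemma cross_vert_class v c : class_at v c ->
  \sum_(l : wsym E * bool | lclass l == c)
    cross_group (fg_letter l) ** st (cross_group (fg_letter l)) = cross_vert v.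
Proof.
move=> cv; apply: cval_inj => k x; rewrite cval_sum cval_cross_vert.
under eq_bigr do rewrite cross_group_range.
have [_|_] /= := eqVneq k 1%g; last by rewrite big1.
have [tc /seteqP[sub sup]] := cdom_class cv.
have [xv|xv] := asboolP (cvert v x).
  have [l lc xl] := sub _ xv; rewrite (bigD1 l) ?lc //= xl big1 ?addr0 //.
  move=> m /andP[/eqP mc ml]; case: (boolP (x _)) => // xm.
  by case/eqP: ml; apply: tc => //; exists x.
rewrite big1 // => l /eqP lc; case: (boolP (x _)) => // xl.
by case: xv; apply: sup; exists l.
Qed.

End ConfigCrossed.

Arguments sa_mul : simpl never.
Arguments sa_star : simpl never.

Section ConfigFamily.
Variables (K : fieldType) (conj : fieldInvolution K) (E : finWeightedGraph).
Local Notation F := (freeGroup (wsym E)).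
Local Notation config := (config E).
Local Notation th := (config_action E).
Local Notation X := (crossed_product conj th).
Local Notation st := (@sa_star _ _ X).
Local Notation cross_vert := (@cross_vert K conj E).
Local Notation cross_group := (@cross_group K conj E).
Local Notation "a ** b" := (@sa_mul _ _ X a b) (at level 40,
  left associativity).

Lemma cross_group_semigroup (a : X) :
  star_semigroup (fun x => cross_group (fg_letter (x, true))) a ->
  exists g, homogeneous g a.
Proof.
elim=> {a} [x|a b _ [g ag] _ [h bh]|a _ [g ag]].
- by exists (fg_letter (x, true)); apply: homogeneous_cross_group.
- by exists (g * h)%g; apply: homogeneousM.
- by exists g^-1%g; apply: homogeneousS.
Qed.

Definition config_family : abFamily E X.
Proof.
apply: (@AbFamily _ _ _ _ cross_vert
  (fun x => cross_group (fg_letter (x, true)))); last first.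
  by move=> a b /cross_group_semigroup[g ag] /cross_group_semigroup[h bh];
    exact: homogeneous_range_comm ag bh.
move=> t t'; case=> {t t'} /=.
- move=> u v; apply: cval_inj => k x; rewrite cross_vertM cval_cross_vert.
  have [<-|uv] := eqVneq u v; rewrite /= ?cval_cross_vert ?cval0.
    by rewrite -natrM mulnb andbCA andbb.
  rewrite -natrM mulnb; case: asboolP => //= xu.
  rewrite asboolF ?andbF // => xv.
  by move/eqP: uv; apply; apply: cvert_inj xv.
- by move=> v; rewrite cross_vert_star.
- by move=> x; apply: (cross_vert_cross_group conj (x, true)).
- move=> x; have := congr1 st (cross_vert_cross_group conj (x, false)).
  by rewrite sa_starM cross_vert_star cross_group_star fg_letterV.
- move=> e i j ij.
  have /(cross_group_orth conj) :
    lclass (wsymb i, false) = lclass (wsymb j, false) by [].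
  rewrite !cross_group_star !fg_letterV; apply; apply/eqP => -[] /eqP.
  by rewrite eq_Tagged => /eqP.
- move=> e e' i j ee' ne ij.
  have /(cross_group_orth conj) :
      lclass (wsymb i, true) = lclass (wsymb j, true).
    by rewrite /lclass /= ee' /windex /= ij.
  by apply; apply/eqP => -[] /ne.
- move=> v i iv; rewrite term_eval_sum /=.
  rewrite -(@cross_vert_class _ _ _ v (inl (v, i))).
    by rewrite sum_class_src.
  by rewrite /= eqxx.
- move=> e; rewrite term_eval_sum /=.
  rewrite -(@cross_vert_class _ _ _ (grng e) (inr e)).
    rewrite sum_class_rng; apply: eq_bigr => i _ /=.
    by rewrite !cross_group_star !fg_letterV /linv.
  by rewrite /= eqxx.
Defined.

End ConfigFamily.

(** * The isomorphism *)

Section Isomorphism.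
Variables (K : fieldType) (conj : fieldInvolution K) (E : finWeightedGraph).
Local Notation F := (freeGroup (wsym E)).
Local Notation config := (config E).
Local Notation th := (config_action E).
Local Notation X := (crossed_product conj th).
Local Notation cross_vert := (@cross_vert K conj E).
Local Notation cross_group := (@cross_group K conj E).
Variables (A : starAlgebra conj) (f : abFamily E A) (f_gen : generating f).
Variable phi : {linear A -> X}.
Hypothesis phiM : {morph phi : a b / sa_mul a b}.
Hypothesis phiS : {morph phi : a / sa_star a}.
Hypothesis phi_v : forall v, phi (fam_v f v) = cross_vert v.
Hypothesis phi_s : forall x, phi (fam_s f x) =
  cross_group (fg_letter (x, true)).

Lemma phi_uletter l : phi (uletter f l) = cross_group (fg_letter l).
Proof.
case: l => x []; rewrite /uletter /= ?phiS phi_s //.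
by rewrite cross_group_star fg_letterV.
Qed.

Lemma phi_ugroup g : phi (ugroup f g) = cross_group g.
Proof.
elim/fg_ind: g => [|l g rg IH].
  rewrite ugroup1 linear_sum cross_group1.
  by apply: eq_bigr => v _; apply: phi_v.
have -> : ugroup f (fg_letter l * g)%g = sa_mul (uletter f l) (ugroup f g).
  by rewrite /ugroup fg_letter_mul.
by rewrite phiM phi_uletter IH cross_groupM.
Qed.

Lemma phi_urange g k x : cval (phi (urange f g)) k x = ((k == 1%g) && x g)%:R.
Proof. by rewrite urangeE phiM phiS phi_ugroup cross_group_range. Qed.

Lemma phi_in_diag_homogeneous b : in_diag f b -> homogeneous 1%g (phi b).
Proof.
elim=> {b} [g|| a b _ a1 _ b1|c a _ a1|a b _ a1 _ b1].
- by move=> k x /negPf k1; rewrite phi_urange k1.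
- by rewrite linear0 => k x _; apply: cval0.
- by rewrite linearD => k x k1; rewrite cvalD a1 // b1 // addr0.
- by rewrite linearZ => k x k1; rewrite cvalZ a1 // mulr0.
- by rewrite phiM -[1%g]mulg1; apply: homogeneousM.
Qed.

(** [b] is a polynomial in finitely many range projections, whose eigenvalues
on [r] are the values at [x] of their images. *)
Lemma in_diag_eigen b : in_diag f b -> exists S : seq F, forall (x : config) r,
  eigen f S x r -> sa_mul b r = cval (phi b) 1%g x *: r.
Proof.
have eigen_cat S S' (x : config) r :
    eigen f (S ++ S') x r -> eigen f S x r /\ eigen f S' x r.
  by move=> xr; split=> g gS; apply: xr; rewrite mem_cat gS ?orbT.
elim=> {b} [g||a b _ [S aS] _ [S' bS]|c a _ [S aS]|a b Ba [S aS] _ [S' bS]].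
- exists [:: g] => x r /(_ g (mem_head _ _)) ->; rewrite phi_urange /=.
  by case: (x g); rewrite ?scale1r ?scale0r.
- by exists [::] => x r _; rewrite sa_mul0l linear0 cval0 scale0r.
- exists (S ++ S') => x r /eigen_cat[xS xS'].
  by rewrite sa_mulDl linearD cvalD scalerDl (aS _ _ xS) (bS _ _ xS').
- by exists S => x r xr; rewrite sa_mulZl linearZ cvalZ -scalerA (aS _ _ xr).
- exists (S ++ S') => x r /eigen_cat[xS xS'].
  rewrite -sa_mulA (bS _ _ xS') sa_mulZr (aS _ _ xS) scalerA phiM.
  by rewrite cval1M 1?mulrC //; apply: phi_in_diag_homogeneous.
Qed.

Lemma phi_in_diag_inj b : in_diag f b -> phi b = 0 -> b = 0.
Proof.
move=> Bb b0; apply: contrapT => /(eigen_config f_gen)[x xP].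
have [S bS] := in_diag_eigen Bb; have [r [Br rb rS]] := xP S.
apply: rb; rewrite (in_diag_comm f_gen Br Bb) (bS _ _ rS).
by rewrite b0 cval0 scale0r.
Qed.

(** Collect the terms of each degree. The images of the components have
different degrees, so each of them vanishes, and the component [b_g u_g] is
recovered from the diagonal element [b_g p_g]. *)
Lemma phi_inj : injective phi.
Proof.
suff phi0 a : phi a = 0 -> a = 0.
  move=> a b ab; apply/eqP; rewrite -subr_eq0; apply/eqP/phi0.
  by rewrite linearB ab subrr.
have [s [sB ->]] := graded_all f_gen a; rewrite (sum_by_key s fst).
set U := undup _; pose b g := \sum_(x <- s | x.1 == g) x.2.
have Bb g : in_diag f (b g).
  rewrite /b big_seq_cond; apply: in_diag_sum => x /andP[xs _]; exact: sB.
rewrite (eq_bigr (fun g => sa_mul (b g) (ugroup f g))) => [|g _]; last first.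
  by rewrite sa_mul_suml; apply: eq_bigr => x /eqP ->.
move=> phi0; rewrite big_seq big1 // => g gU.
have bg : sa_mul (b g) (urange f g) = 0.
  apply: phi_in_diag_inj; first by apply: in_diag_mul => //; apply: in_diag_p.
  apply: cval_inj => k x; rewrite cval0 phiM.
  rewrite cval1M ?phi_urange; last exact: phi_in_diag_homogeneous.
  have := congr1 (fun c => cval c g x) phi0; rewrite cval0 linear_sum cval_sum.
  rewrite (bigD1_seq g) ?undup_uniq //= phiM phi_ugroup cval1M;
    last exact: phi_in_diag_homogeneous.
  rewrite big1 ?addr0.
    by rewrite cval_cross_group eqxx /=; case: (k == _); rewrite ?mulr0.
  move=> h hg; rewrite phiM phi_ugroup cval1M ?cval_cross_group;
    last exact: phi_in_diag_homogeneous.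
  by rewrite eq_sym (negPf hg) mulr0.
by rewrite -(urange_ugroup f_gen) sa_mulA bg sa_mul0l.
Qed.

(** The functions that lie in the image when placed in degree [1]. *)
Definition in_image (h : config -> K) : Prop :=
  exists a, forall k x, cval (phi a) k x = if k == 1%g then h x else 0.

Lemma in_image_homogeneous a h :
  (forall k x, cval (phi a) k x = if k == 1%g then h x else 0) ->
  homogeneous 1%g (phi a).
Proof. by move=> ah k x /negPf k1; rewrite ah k1. Qed.

Lemma in_imageD h h' :
  in_image h -> in_image h' -> in_image (fun x => h x + h' x).
Proof.
move=> [a aE] [b bE]; exists (a + b) => k x.
by rewrite linearD cvalD aE bE; case: ifP; rewrite ?addr0.
Qed.

Lemma in_imageZ c h : in_image h -> in_image (fun x => c * h x).
Proof.
move=> [a aE]; exists (c *: a) => k x.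
by rewrite linearZ cvalZ aE; case: ifP; rewrite ?mulr0.
Qed.

Lemma in_imageM h h' :
  in_image h -> in_image h' -> in_image (fun x => h x * h' x).
Proof.
move=> [a aE] [b bE]; exists (sa_mul a b) => k x.
rewrite phiM cval1M; last exact: in_image_homogeneous aE.
by rewrite aE bE eqxx; case: ifP; rewrite ?mulr0.
Qed.

Lemma in_image_at g : in_image (fun x => (x g)%:R).
Proof. by exists (urange f g) => k x; rewrite phi_urange; case: (k == 1%g). Qed.

Lemma in_image1 : in_image (fun=> 1).
Proof.
by have [a aE] := in_image_at 1%g; exists a => k x; rewrite aE config1.
Qed.

Lemma in_image_eq h h' : (forall x, h x = h' x) -> in_image h -> in_image h'.
Proof. by move=> hh [a aE]; exists a => k x; rewrite aE hh. Qed.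

Lemma in_image_agree S (x : config) :
  in_image (fun y => (`[< agree S x y >])%:R).
Proof.
elim: S => [|g S IH].
  by apply: in_image_eq in_image1 => y; rewrite asboolT.
have Ig : in_image (fun y : config => (y g == x g)%:R).
  case: (x g); first by apply: in_image_eq (in_image_at g) => y; rewrite eqb_id.
  apply: in_image_eq (in_imageD in_image1 (in_imageZ (-1) (in_image_at g))) =>
    y /=.
  by case: (y g); rewrite mulN1r ?subrr ?subr0.
apply: in_image_eq (in_imageM Ig IH) => y.
rewrite -natrM mulnb; congr ((nat_of_bool _)%:R).
apply/andP/asboolP => [[/eqP yg /asboolP yS] h|yS].
  by rewrite inE => /predU1P[->|/yS].
split; first by apply/eqP/yS/mem_head.
by apply/asboolP => h hS; apply: yS; rewrite inE hS orbT.
Qed.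

(** Call a set of configurations good if its indicator and the product of [h]
with its indicator are in the image. Finite unions of good sets are good. If
the whole space were not good, the complements of good sets would be a filter
base, with a cluster point by compactness; but every point has a good
neighbourhood, namely a cylinder on which [h] is constant. *)
Lemma in_image_cont (h : config -> K) :
  (forall x, \forall y \near x, h y = h x) -> in_image h.
Proof.
move=> hc.
pose N := [set C : set config | in_image (fun x => (`[< C x >])%:R) /\
                                in_image (fun x => h x * (`[< C x >])%:R)].
have N0 : N set0.
  have I0 : in_image (fun=> 0).
    by apply: in_image_eq (in_imageZ 0 in_image1) => x; rewrite mul0r.
  by split; apply: in_image_eq I0 => x; rewrite asboolF ?mulr0.
have NU C D : N C -> N D -> N (C `|` D).
  move=> [IC hC] [ID hD].
  have UE x : (`[< (C `|` D) x >])%:R =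
      (`[< C x >])%:R + (`[< D x >])%:R +
      -1 * ((`[< C x >])%:R * (`[< D x >])%:R) :> K.
    rewrite asbool_or; case: `[< C x >]; case: `[< D x >] => /=;
    by rewrite ?mulr0 ?mul0r ?mulr1 ?mulN1r ?addr0 ?add0r ?addrK ?subr0.
  split.
    have := in_imageD (in_imageD IC ID) (in_imageZ (-1) (in_imageM IC ID)).
    by apply: in_image_eq => x; rewrite UE.
  have := in_imageD (in_imageD hC hD) (in_imageZ (-1) (in_imageM hC ID)).
  apply: in_image_eq => x.
  by rewrite UE !mulrDr (mulrCA (h x)) (mulrA (h x)).
have [NT|NT] := pselect (N setT).
  by case: NT => _; apply: in_image_eq => x; rewrite asboolT // mulr1.
have FN : ProperFilter (filter_from N (fun C => ~` C)).
  apply: filter_from_proper; last first.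
    move=> C NC; apply: contrapT => C0; apply: NT; suff <- : C = setT by [].
    by apply/seteqP; split=> // x _; apply: contrapT => Cx; apply: C0; exists x.
  apply: filter_from_filter; first by exists set0.
  by move=> C D NC ND; exists (C `|` D); [apply: NU|rewrite setCU].
have FT : filter_from N (fun C => ~` C) setT by exists set0.
have [x [_ xF]] := @config_compact E _ FN FT.
have [S hS] := hc x.
have NS : N (agree S x).
  split; first exact: in_image_agree.
  apply: in_image_eq (in_imageZ (h x) (in_image_agree S x)) => y.
  by case: asboolP => [/hS ->|]; rewrite ?mulr0.
have FS : filter_from N (fun C => ~` C) (~` agree S x) by exists (agree S x).
by have [y []] := xF _ _ FS (nbhs_agree S x).
Qed.

(** An element of the crossed product is a finite sum of terms
[h delta_g = (h delta_1) (1_(dom g) delta_g)]. *)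
Lemma phi_surj (c : X) : exists a, phi a = c.
Proof.
have cI g : in_image (cval c g).
  by apply: in_image_cont => x; apply: crossed_near.
have [a aE] := choice cI.
have [D cD] := is_crossed_supp (crossedP c).
exists (\sum_(g <- D) sa_mul (a g) (ugroup f g)); apply: cval_inj => k x.
rewrite linear_sum cval_sum.
transitivity (\sum_(g <- D) if g == k then cval c k x else 0).
  apply: eq_bigr => g _; rewrite phiM phi_ugroup cval1M;
    last exact: in_image_homogeneous (aE g).
  rewrite aE eqxx cval_cross_group [k == g]eq_sym.
  have [->|_] /= := eqVneq g k; last by rewrite mulr0.
  have [_|xk] := boolP (x k); first by rewrite mulr1.
  by rewrite crossed_dom ?mul0r //; apply/negP.
have [kD|kD] := boolP (k \in D).
  rewrite (bigD1_seq k) ?fset_uniq //= eqxx big1 ?addr0 // => g /negPf -> //.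
rewrite big_seq big1 => [|g gD]; first by apply/esym/cD.
by case: eqP => // gk; rewrite -gk gD in kD.
Qed.

Lemma phi_bij : bijective phi.
Proof.
have [psi psiK] := choice phi_surj.
by exists psi => // a; apply: phi_inj; apply: psiK.
Qed.

End Isomorphism.

Theorem theorem4p7 (K : fieldType) (conj : fieldInvolution K)
    (E : finWeightedGraph) :
  exists Omega : dynSystem E,
    universal_system Omega /\
    exists theta : partialAction (freeGroup (wsym E)) Omega,
      extends_system theta /\
      star_isomorphic (Lab conj E) (crossed_product conj theta).
Proof.
exists (config_system E); split; first exact: config_universal.
exists (config_action E); split; first exact: config_extends.
have [phi [phiM phiS phi_v phi_s]] := lab_lift (config_family conj E).
exists phi; split=> //.
exact: (phi_bij (@lab_generating K conj E) phiM phiS phi_v phi_s).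
Qed.
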